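(* Let $N(c)$ be a $(2m+1)$-dimensional $(\kappa,\mu)$-contact space form of constant $\varphi$-sectional curvature $c$, endowed with the connection $\overline{\nabla}_XY=\widehat{\overline{\nabla}}_XY+\lambda_1\pi(Y)X-\lambda_2 g(X,Y)P$, and let $M^n$, $n\ge 3$, be an $n$-dimensional submanifold of $N(c)$. Then for any integer $k$, $2\le k\le n$, and any point $x\in M$, \begin{align*} n(n-1)\|H\|^2(x)\ge{}& n(n-1)\Theta_k(x)-\frac{c+3}{4}(n-1)n-\frac{3(c-1)}{4}\|\widehat{P}\|^2+\frac{c+3-4\kappa}{2}(n-1)\|\xi^\top\|^2\\ &-\frac12\left[\|(\varphi h')^\top\|^2-\|(h')^\top\|^2+|\mathrm{tr}((h')^\top)|^2-|\mathrm{tr}((\varphi h')^\top)|^2\right]\\ &-2(n-1)\mathrm{tr}((h')^\top)-2(1-\mu)\left[g(\xi^\top,h'\xi^\top)-\mathrm{tr}((h')^\top)\|\xi^\top\|^2\right]\\ &+\lambda(n-1)(\lambda_1+\lambda_2)+\lambda_2(\lambda_1-\lambda_2)(n-1)\,\mathrm{tr}(\beta)+(n-1)n(\lambda_1-\lambda_2)\pi(H). \end{align*}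
   Context: **Ambient manifold.** A Riemannian manifold $(N^{2m+1},g)$ has an almost contact metric structure $(\varphi,\xi,\eta,g)$ if $\varphi$ is a $(1,1)$-tensor field, $\xi$ a vector field, $\eta$ a $1$-form with $\varphi^2X=-X+\eta(X)\xi$, $\eta(\xi)=1$, $\varphi\xi=0$, $\eta\circ\varphi=0$, $g(X,\varphi Y)=-g(\varphi X,Y)$, $g(X,\xi)=\eta(X)$. It is a contact metric manifold if $\Phi=d\eta$, where $\Phi(X,Y)=g(X,\varphi Y)$. Let $\widehat{\overline{\nabla}}$ be the Levi-Civita connection of $g$ and $\widehat{\overline{R}}$ its curvature tensor. The tensor $h'$ defined by $2h'=\mathcal L_\xi\varphi$ is symmetric, and $h'\xi=0$, $h'\varphi+\varphi h'=0$, $\widehat{\overline{\nabla}}\xi=-\varphi-\varphi h'$, and $h'$ and $\varphi h'$ are trace-free on $TN$. $N$ is a $(\kappa,\mu)$-contact metric manifold ($\kappa,\mu$ real constants) if $\widehat{\overline{R}}(X,Y)\xi=\kappa[\eta(Y)X-\eta(X)Y]+\mu[\eta(Y)h'X-\eta(X)h'Y]$. A $\varphi$-section is a plane spanned by $X,\varphi X$ with $X$ a unit vector orthogonal to $\xi$; its sectional curvature is a $\varphi$-sectional curvature. If a $(\kappa,\mu)$-contact metric manifold has constant $\varphi$-sectional curvature $c$ it is called a $(\kappa,\mu)$-contact space form $N(c)$, and its Levi-Civita curvature tensor is \begin{align*}\widehat{\overline{R}}(X,Y)Z={}&\tfrac{c+3}{4}[g(Y,Z)X-g(X,Z)Y]+\tfrac{c+3-4\kappa}{4}[\eta(X)\eta(Z)Y-\eta(Y)\eta(Z)X+g(X,Z)\eta(Y)\xi-g(Y,Z)\eta(X)\xi]\\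 &+\tfrac{c-1}{4}[2g(X,\varphi Y)\varphi Z+g(X,\varphi Z)\varphi Y-g(Y,\varphi Z)\varphi X]\\ &+\tfrac12[g(h'Y,Z)h'X-g(h'X,Z)h'Y+g(\varphi h'X,Z)\varphi h'Y-g(\varphi h'Y,Z)\varphi h'X]\\ &-g(X,Z)h'Y+g(Y,Z)h'X+\eta(X)\eta(Z)h'Y-\eta(Y)\eta(Z)h'X-g(h'X,Z)Y+g(h'Y,Z)X\\ &-g(h'Y,Z)\eta(X)\xi+g(h'X,Z)\eta(Y)\xi\\ &+\mu[\eta(Y)\eta(Z)h'X-\eta(X)\eta(Z)h'Y+g(h'Y,Z)\eta(X)\xi-g(h'X,Z)\eta(Y)\xi].\end{align*} **Connection.** $P$ is a vector field on $N$, $\pi(X)=g(P,X)$, $\lambda_1,\lambda_2$ are real constants, and $\overline{\nabla}_XY=\widehat{\overline{\nabla}}_XY+\lambda_1\pi(Y)X-\lambda_2g(X,Y)P$. Define the $(0,2)$-tensors $\alpha(X,Y)=(\widehat{\overline{\nabla}}_X\pi)(Y)-\lambda_1\pi(X)\pi(Y)+\frac{\lambda_2}{2}g(X,Y)\pi(P)$ and $\beta(X,Y)=\frac{\pi(P)}{2}g(X,Y)+\pi(X)\pi(Y)$. **Submanifold.** For tangent $X,Y$ on $M$, $\overline{\nabla}_XY=\nabla_XY+h(X,Y)$ is the decomposition into tangential part (induced connection $\nabla$) and normal part $h$; one has $h=\widehat h-\lambda_2 g\,P^\bot$, with $\widehat h$ the usual second fundamental form and $P^\bot$ the normal part of $P$.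 $R(X,Y)Z=\nabla_X\nabla_YZ-\nabla_Y\nabla_XZ-\nabla_{[X,Y]}Z$ and $R(X,Y,Z,W)=g(R(X,Y)Z,W)$. Let $e_1,\dots,e_n$ be an orthonormal basis of $T_xM$; $H=\frac1n\sum_i h(e_i,e_i)$. For a $2$-plane $\Pi$ with orthonormal basis $\{e_1,e_2\}$, $K(\Pi)=\frac12[R(e_1,e_2,e_2,e_1)-R(e_1,e_2,e_1,e_2)]$ (independent of the basis). **$k$-Ricci curvature.** For a $k$-plane section $L\subset T_xM$ and a unit vector $X\in L$, choose an orthonormal frame $e_1,\dots,e_k$ of $L$ with $e_1=X$ and put $\mathrm{Ric}_L(X)=K_{12}+\cdots+K_{1k}$, $K_{1j}=K(e_1\wedge e_j)$. For $2\le k\le n$, $\Theta_k(x)=\frac1{k-1}\inf\{\mathrm{Ric}_L(X)\mid L,X\}$, where $L$ runs over all $k$-plane sections in $T_xM$ and $X$ over all unit vectors in $L$. **Notation.** Traces are over $T_xM$: $\lambda=\mathrm{tr}(\alpha)=\sum_{i=1}^n\alpha(e_i,e_i)$, $\mathrm{tr}(\beta)=\sum_{i=1}^n\beta(e_i,e_i)$. $\xi^\top$ is the tangential part of $\xi$; $\widehat PX$, $(h')^\top X$, $(\varphi h')^\top X$ are the tangential parts of $\varphi X$, $h'X$, $\varphi h'X$ for tangent $X$; $\|\vartheta\|^2=\sum_{i,j=1}^n g(e_i,\vartheta e_j)^2$ and $\mathrm{tr}(\vartheta)=\sum_{i=1}^n g(e_i,\vartheta e_i)$ for $\vartheta\in\{\widehat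 P,(h')^\top,(\varphi h')^\top\}$. *)

(* Defs.v *)
(* Submanifolds of (kappa, mu)-contact space forms endowed with the connection
   Y |-> D_X Y + l1 pi(Y) X - l2 g(X, Y) P, where D is the Levi-Civita connection. *)
From HB Require Import structures.
From mathcomp Require Import all_boot all_order all_algebra.
From mathcomp Require Import all_classical all_reals all_analysis.

Set Implicit Arguments.
Unset Strict Implicit.
Unset Printing Implicit Defensive.

Import Order.TTheory GRing.Theory Num.Theory.
Import numFieldNormedType.Exports.

Local Open Scope classical_set_scope.
Local Open Scope ring_scope.

Section Calculus.
Context {R : realType} {d : nat}.

(* Meaningful for open U. *)
Fixpoint Ck (k : nat) (U : set 'rV[R]_d) (f : 'rV[R]_d -> R) : Prop :=
  if k is k'.+1
  then (forall x, U x -> differentiable f x) /\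
       (forall v, Ck k' U (fun x => 'D_v f x))
  else forall x, U x -> {for x, continuous f}.

Definition Cinfty (U : set 'rV[R]_d) (f : 'rV[R]_d -> R) : Prop :=
  forall k, Ck k U f.

End Calculus.

Record chart (R : realType) (d : nat) (T : topologicalType) := Chart {
  cdom : set T;
  cfun : T -> 'rV[R]_d;
  cinv : 'rV[R]_d -> T;
  cdom_open : open cdom;
  cimg_open : open (cfun @` cdom);
  cfunK : forall p, cdom p -> cinv (cfun p) = p;
  cfun_cont : forall p, cdom p -> {for p, continuous cfun};
  cinv_cont : forall y, (cfun @` cdom) y -> {for y, continuous cinv} }.

Definition smooth_transition (R : realType) (d : nat) (T : topologicalType)
    (a b : chart R d T) : Prop :=
  forall i : 'I_d,
    Cinfty (cfun a @` (cdom a `&` cdom b)) (fun y => cfun b (cinv a y) 0 i).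

(* [atlas] is a maximal smooth atlas, i.e. a smooth structure. *)
Record manifold (R : realType) (d : nat) := Manifold {
  points :> topologicalType;
  atlas : set (chart R d points);
  points_hausdorff : hausdorff_space points;
  points_countable : @second_countable points;
  atlas_cover : forall p : points, exists2 a, atlas a & cdom a p;
  atlas_smooth : forall a b, atlas a -> atlas b -> smooth_transition a b;
  atlas_maximal : forall a,
    (forall b, atlas b -> smooth_transition a b /\ smooth_transition b a) ->
    atlas a }.

(* Tangent vectors act on functions as directional derivatives; tangent spaces
   are subsets of the vector space of all functionals. *)
Notation functional N R := ((points N -> R) -> R).

Section Manifold.
Context {R : realType} {d : nat} (N : manifold R d).
Local Notation V := (functional N R).
Implicit Types (p q : N) (u v w : V) (X Y Z : N -> V) (U W : set N)
  (f : N -> R).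

Definition smooth_on U f : Prop :=
  forall a, @atlas R d N a ->
    Cinfty (cfun a @` (U `&` cdom a)) (fun y => f (cinv a y)).

Definition smooth_near p f : Prop :=
  exists2 U, open_nbhs p U & smooth_on U f.

(* The directional derivative along y in the chart a at p. The value 0 on
   functions that are not smooth near p is a convention: it makes a tangent
   vector determined by its action on the smooth ones. *)
Definition dir_deriv (a : chart R d N) p (y : 'rV[R]_d) : V :=
  fun f => if `[< smooth_near p f >]
           then 'D_y (fun z => f (cinv a z)) (cfun a p) else 0.

Definition tangent p : set V :=
  [set v | exists a y, [/\ @atlas R d N a, cdom a p & v = dir_deriv a p y]].

Definition vector_field U X : Prop :=
  [/\ open U, (forall p, U p -> tangent p (X p)) &
      forall W f, open W -> W `<=` U -> smooth_on W f ->
        smooth_on W (fun q => X q f)].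

Definition vector_field_near p X : Prop :=
  exists2 U, open_nbhs p U & vector_field U X.

Definition bracket X Y : N -> V := fun p f =>
  if `[< smooth_near p f >]
  then X p (fun q => Y q f) - Y p (fun q => X q f) else 0.

Definition riemannian_metric (g : N -> V -> V -> R) : Prop :=
  [/\ forall p u v w (a : R), tangent p u -> tangent p v -> tangent p w ->
        g p (a *: u + v) w = a * g p u w + g p v w,
      forall p u v, tangent p u -> tangent p v -> g p u v = g p v u,
      forall p u, tangent p u -> u != 0 -> 0 < g p u u &
      forall U X Y, vector_field U X -> vector_field U Y ->
        smooth_on U (fun q => g q (X q) (Y q))].

(* D p u Y is the covariant derivative at p of the field Y (defined near p)
   in the direction u. *)
Record affine_connection (D : N -> V -> (N -> V) -> V) : Prop := {
  conn_tangent : forall p u Y, tangent p u -> vector_field_near p Y ->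
    tangent p (D p u Y);
  conn_local : forall p u Y Y', tangent p u -> vector_field_near p Y ->
    (\forall q \near p, Y q = Y' q) -> D p u Y = D p u Y';
  conn_linear : forall p u v Y (a : R), tangent p u -> tangent p v ->
    vector_field_near p Y -> D p (a *: u + v) Y = a *: D p u Y + D p v Y;
  conn_add : forall p u Y Z, tangent p u -> vector_field_near p Y ->
    vector_field_near p Z -> D p u (fun q => Y q + Z q) = D p u Y + D p u Z;
  conn_leibniz : forall p u f Y, tangent p u -> smooth_near p f ->
    vector_field_near p Y ->
    D p u (fun q => f q *: Y q) = u f *: Y p + f p *: D p u Y;
  conn_smooth : forall U X Y, vector_field U X -> vector_field U Y ->
    vector_field U (fun q => D q (X q) Y) }.

Definition levi_civita (g : N -> V -> V -> R) (D : N -> V -> (N -> V) -> V) :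
    Prop :=
  [/\ affine_connection D,
      forall p X Y, vector_field_near p X -> vector_field_near p Y ->
        D p (X p) Y - D p (Y p) X = bracket X Y p &
      forall p u Y Z, tangent p u -> vector_field_near p Y ->
        vector_field_near p Z ->
        u (fun q => g q (Y q) (Z q)) = g p (D p u Y) (Z p) + g p (Y p) (D p u Z)].

Definition curvature (D : N -> V -> (N -> V) -> V) p X Y Z : V :=
  D p (X p) (fun q => D q (Y q) Z) - D p (Y p) (fun q => D q (X q) Z)
  - D p (bracket X Y p) Z.

(* Some vector field near p with value w at p; only used in expressions that
   do not depend on its choice. *)
Definition extend p w : N -> V :=
  xget (fun=> 0) [set Y | vector_field_near p Y /\ Y p = w].

Record almost_contact_metric (g : N -> V -> V -> R) (phi : N -> V -> V)
    (xi : N -> V) (eta : N -> V -> R) : Prop := {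
  ac_metric : riemannian_metric g;
  ac_phi_tangent : forall p u, tangent p u -> tangent p (phi p u);
  ac_phi_linear : forall p u v (a : R), tangent p u -> tangent p v ->
    phi p (a *: u + v) = a *: phi p u + phi p v;
  ac_phi_smooth : forall U X, vector_field U X ->
    vector_field U (fun q => phi q (X q));
  ac_xi : vector_field setT xi;
  ac_phi2 : forall p u, tangent p u ->
    phi p (phi p u) = - u + eta p u *: xi p;
  ac_eta_xi : forall p, eta p (xi p) = 1;
  ac_phi_xi : forall p, phi p (xi p) = 0;
  ac_eta_phi : forall p u, tangent p u -> eta p (phi p u) = 0;
  ac_g_phi : forall p u v, tangent p u -> tangent p v ->
    g p u (phi p v) = - g p (phi p u) v;
  ac_g_xi : forall p u, tangent p u -> g p u (xi p) = eta p u }.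

(* The factor 1/2 in d eta is the convention under which
   D xi = - phi - phi h'. *)
Definition contact_metric (g : N -> V -> V -> R) (phi : N -> V -> V)
    (xi : N -> V) (eta : N -> V -> R) : Prop :=
  almost_contact_metric g phi xi eta /\
  forall p X Y, vector_field_near p X -> vector_field_near p Y ->
    g p (X p) (phi p (Y p)) =
    2%:R^-1 * (X p (fun q => eta q (Y q)) - Y p (fun q => eta q (X q))
               - eta p (bracket X Y p)).

Definition lie_phi (phi : N -> V -> V) (xi : N -> V) p X : V :=
  bracket xi (fun q => phi q (X q)) p - phi p (bracket xi X p).

Definition kappa_mu_contact_metric (g : N -> V -> V -> R) (phi : N -> V -> V)
    (xi : N -> V) (eta : N -> V -> R) (h' : N -> V -> V)
    (D : N -> V -> (N -> V) -> V) (kappa mu : R) : Prop :=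
  [/\ contact_metric g phi xi eta,
      forall p X, vector_field_near p X ->
        2%:R *: h' p (X p) = lie_phi phi xi p X,
      levi_civita g D &
      forall p X Y, vector_field_near p X -> vector_field_near p Y ->
        curvature D p X Y xi =
        kappa *: (eta p (Y p) *: X p - eta p (X p) *: Y p)
        + mu *: (eta p (Y p) *: h' p (X p) - eta p (X p) *: h' p (Y p))].

Definition sectional_curvature (g : N -> V -> V -> R)
    (D : N -> V -> (N -> V) -> V) p X Y : R :=
  g p (curvature D p X Y Y) (X p)
  / (g p (X p) (X p) * g p (Y p) (Y p) - g p (X p) (Y p) ^+ 2).

Definition space_form_curvature (g : N -> V -> V -> R) (phi : N -> V -> V)
    (xi : N -> V) (eta : N -> V -> R) (h' : N -> V -> V) (kappa mu c : R)
    p (X Y Z : V) : V :=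
  let gg := g p in let f := phi p in let h := h' p in let x := xi p in
  let e := eta p in let fh := fun v => phi p (h' p v) in
  ((c + 3%:R) / 4%:R) *: (gg Y Z *: X - gg X Z *: Y)
  + ((c + 3%:R - 4%:R * kappa) / 4%:R) *:
      ((e X * e Z) *: Y - (e Y * e Z) *: X
       + (gg X Z * e Y) *: x - (gg Y Z * e X) *: x)
  + ((c - 1) / 4%:R) *:
      ((2%:R * gg X (f Y)) *: f Z + gg X (f Z) *: f Y - gg Y (f Z) *: f X)
  + 2%:R^-1 *:
      (gg (h Y) Z *: h X - gg (h X) Z *: h Y
       + gg (fh X) Z *: fh Y - gg (fh Y) Z *: fh X)
  - gg X Z *: h Y + gg Y Z *: h X
  + (e X * e Z) *: h Y - (e Y * e Z) *: h X
  - gg (h X) Z *: Y + gg (h Y) Z *: X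
  - (gg (h Y) Z * e X) *: x + (gg (h X) Z * e Y) *: x
  + mu *:
      ((e Y * e Z) *: h X - (e X * e Z) *: h Y
       + (gg (h Y) Z * e X) *: x - (gg (h X) Z * e Y) *: x).

(* By a classical theorem the last clause follows from the first two; the
   curvature tensor is recorded as part of the notion of space form. *)
Definition contact_space_form (g : N -> V -> V -> R) (phi : N -> V -> V)
    (xi : N -> V) (eta : N -> V -> R) (h' : N -> V -> V)
    (D : N -> V -> (N -> V) -> V) (kappa mu c : R) : Prop :=
  [/\ kappa_mu_contact_metric g phi xi eta h' D kappa mu,
      forall p X, vector_field_near p X ->
        g p (X p) (X p) = 1 -> g p (X p) (xi p) = 0 ->
        sectional_curvature g D p X (fun q => phi q (X q)) = c &
      forall p X Y Z, vector_field_near p X -> vector_field_near p Y ->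
        vector_field_near p Z ->
        curvature D p X Y Z =
        space_form_curvature g phi xi eta h' kappa mu c p (X p) (Y p) (Z p)].

(* The connection nabla-bar, with pi(X) = g(P, X); it is taken at a point, in
   the direction u, of a field Y. *)
Section Connection.
Variables (g : N -> V -> V -> R) (D : N -> V -> (N -> V) -> V).
Variables (P : N -> V) (l1 l2 : R).

Definition one_form p u : R := g p (P p) u.

Definition conn_bar p u Y : V :=
  D p u Y + (l1 * one_form p (Y p)) *: u - (l2 * g p u (Y p)) *: P p.

Definition cov_one_form p u w : R :=
  let Y := extend p w in
  u (fun q => one_form q (Y q)) - one_form p (D p u Y).

Definition tensor_alpha p u w : R :=
  cov_one_form p u w - l1 * one_form p u * one_form p w
  + l2 / 2%:R * g p u w * one_form p (P p).

Definition tensor_beta p u w : R :=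
  one_form p (P p) / 2%:R * g p u w + one_form p u * one_form p w.

End Connection.

(* [M] is a submanifold of dimension [n]: it has slice charts; its tangent
   spaces are subspaces of those of [N]. *)
Section Submanifold.
Variables (n : nat) (M : set N).

Definition slice_chart (a : chart R d N) : Prop :=
  @atlas R d N a /\
  forall q, cdom a q -> (M q <-> forall j : 'I_d, (n <= j)%N -> cfun a q 0 j = 0).

Definition submanifold : Prop :=
  (n <= d)%N /\ forall p, M p -> exists2 a, slice_chart a & cdom a p.

Definition tangent_sub p : set V :=
  [set v | exists a (y : 'rV[R]_d), [/\ slice_chart a, cdom a p,
     (forall j : 'I_d, (n <= j)%N -> y 0 j = 0) & v = dir_deriv a p y]].

(* A vector field on M near p, as a field on N near p tangent to M along M. *)
Definition sub_field_near p X : Prop :=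
  vector_field_near p X /\ \forall q \near p, M q -> tangent_sub q (X q).

Definition sub_extend p u : N -> V :=
  xget (fun=> 0) [set X | sub_field_near p X /\ X p = u].

(* An extension to N, near p, of a field of vectors given along M. *)
Definition along_extend p Y : N -> V :=
  xget (fun=> 0) [set Y' | vector_field_near p Y' /\
                           \forall q \near p, M q -> Y' q = Y q].

Section Induced.
Variables (g : N -> V -> V -> R) (D : N -> V -> (N -> V) -> V).

Definition tan_part p v : V :=
  xget 0 [set u | tangent_sub p u /\
                  forall w, tangent_sub p w -> g p (v - u) w = 0].

(* Gauss decomposition of an ambient connection D: induced connection on M and
   second fundamental form. *)
Definition induced_conn p u Y : V := tan_part p (D p u (along_extend p Y)).

Definition second_form p u w : V :=
  let Y := sub_extend p w in D p u Y - tan_part p (D p u Y).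

Definition sub_curvature p u v w z : R :=
  g p (curvature induced_conn p (sub_extend p u) (sub_extend p v)
         (sub_extend p w)) z.

Definition sub_sectional p u v : R :=
  2%:R^-1 * (sub_curvature p u v v u - sub_curvature p u v u v).

Definition orthonormal_frame (k : nat) p (e : nat -> V) : Prop :=
  forall i j : nat, (i < k)%N -> (j < k)%N ->
    tangent_sub p (e i) /\ g p (e i) (e j) = (i == j)%:R.

Definition orthonormal_basis p (e : nat -> V) : Prop :=
  orthonormal_frame n p e /\
  forall v, tangent_sub p v ->
    exists a : nat -> R, v = \sum_(i < n) a i *: e i.

Definition mean_curvature p (e : nat -> V) : V :=
  n%:R^-1 *: \sum_(i < n) second_form p (e i) (e i).

(* The k-Ricci curvature Ric_L(X) for an orthonormal frame e of L with
   X = e 0; pairs (L, X) are thus given by orthonormal k-frames. *)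
Definition k_ricci (k : nat) p (e : nat -> V) : R :=
  \sum_(1 <= j < k) sub_sectional p (e 0%N) (e j).

Definition Theta (k : nat) p : R :=
  (k.-1)%:R^-1 * inf [set k_ricci k p e | e in orthonormal_frame k p].

(* Traces and norms over T_pM, in an orthonormal basis e. *)
Definition bilinear_trace (B : V -> V -> R) (e : nat -> V) : R :=
  \sum_(i < n) B (e i) (e i).

Definition endo_trace p (A : V -> V) (e : nat -> V) : R :=
  \sum_(i < n) g p (e i) (A (e i)).

Definition endo_norm2 p (A : V -> V) (e : nat -> V) : R :=
  \sum_(i < n) \sum_(j < n) g p (e i) (A (e j)) ^+ 2.

End Induced.
End Submanifold.
End Manifold.

(* Main.v *)
(* For fields X, Y, Z, W tangent to M, differentiating the tangential part of
   nabla-bar_Y Z along X and moving the derivative of its normal part onto W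
   gives a Gauss equation for the induced connection: R(X,Y,Z,W) is the curvature
   of the space form, plus g(h(Y,Z),h(X,W)) - g(h(X,Z),h(Y,W)), plus terms in
   pi, in D pi and in h.  Summed over e_i, e_j it expresses
   sum_{i,j} K(e_i,e_j) through the invariants of the statement and
   n^2 |H|^2 - |h|^2, and n |H|^2 <= |h|^2 by Cauchy-Schwarz.  Averaging the
   k-Ricci curvatures of the frames obtained by permuting e_1,...,e_n gives
   n (n - 1) Theta_k <= sum_{i,j} K(e_i,e_j).
   The traces of h' and phi h' are those of symmetric endomorphisms: with
   S(u,v) = g(D_u xi,v) + g(u,D_v xi), the Lie derivative of g along xi,
   d(d eta) = 0 gives 2 g(u,h'v) = - S(u,phi v), and h' phi + phi h' = 0. *)

Require Import Defs.
From HB Require Import structures.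
From mathcomp Require Import all_boot all_order all_algebra fingroup perm.
From mathcomp Require Import all_classical all_reals all_analysis.
From mathcomp Require Import ring lra.

Set Implicit Arguments.
Unset Strict Implicit.
Unset Printing Implicit Defensive.

Import Order.TTheory GRing.Theory Num.Theory.
Import numFieldNormedType.Exports.

Local Open Scope classical_set_scope.
Local Open Scope ring_scope.

(** The induced connection is computed by extending fields from [M] to [N], and curvature iterates
    it, so the tangential part of a smooth field must again extend smoothly: a Gram-Schmidt
    projection in slice charts provides this. That extensions do not matter is shown without frames:
    a derivative along [M] is tested against a field taking its own value, and metric compatibility
    reduces the claim to functions vanishing on [M]. [h'] is given only through fields, so even its
    linearity at a point is read off its relation to the Lie derivative of the metric. That relation
    rests on L_xi eta = 0. When [l1] and [l2] differ, nabla-bar is not metric and R(X,Y,Z,W) need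
    not be antisymmetric in Z, W; the antisymmetrization in K disappears on summing over all ordered
    pairs i, j. As [Theta] is an infimum, K needs a lower bound on unit vectors, which comes from
    multilinearity. Alpha and beta enter only at the end: their traces recombine the sums of
    g(D_{e_i} P, e_i) and pi(e_i)^2 and the multiple of pi(P) left by the Gauss equation. *)

Section NearDifferentiable.
Context {R : numFieldType} {V W : normedModType R}.

Lemma near0_differentiable (f : V -> W) x :
  (\near x, f x = 0) -> differentiable f x.
Proof.
move=> f0; have fx0 : f x = 0 by exact: nbhs_singleton f0.
apply/diffP => /=.
(* The differential is picked by a choice operator, so exhibiting one continuous linear map with the
   right expansion suffices; here it is the zero map. *)
apply: (@getPex _ (fun (df : {linear V -> W}) => continuous df /\
  forall y, f y = f (lim (nbhs x)) + df (y - lim (nbhs x))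
                  +o_(y \near x) (y - lim (nbhs x)))).
exists (\0 : {linear V -> W}); split=> /=; first exact: cst_continuous.
have o_f : f = (fun y => f (lim (nbhs x)) + (\0 : {linear V -> W}) (y - lim (nbhs x)))
    +o_x (fun y => y - lim (nbhs x)).
  apply/eqaddoP => eps eps0; near=> y.
  rewrite !fctE lim_id // fx0 (near f0 y) // !(subr0, addr0) normr0.
  by rewrite mulr_ge0 // ltW.
by move=> y; rewrite {1}o_f.
Unshelve. all: by end_near. Qed.

(** Functions are total but smoothness is prescribed only on open sets, so differentiability must be
    seen to depend on the germ alone: [g - f] vanishes near [x]. *)
Lemma near_eq_differentiable (f g : V -> W) x :
  (\near x, f x = g x) -> differentiable f x -> differentiable g x.
Proof.
move=> fg df; have -> : g = f + (g - f) by rewrite addrC subrK.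
apply: differentiableD => //; apply: near0_differentiable.
by near do rewrite fctE; near=> y; rewrite !fctE (near fg y) // subrr.
Unshelve. all: by end_near. Qed.

End NearDifferentiable.

(** * Calculus of smooth functions on open subsets of R^d *)

Section Smooth.
Context {R : realType} {d : nat}.
Local Notation E := 'rV[R]_d.
Implicit Types (U W : set E) (f g : E -> R) (v : E).

Lemma near_open U x : open U -> U x -> \forall y \near x, U y.
Proof. by move=> oU Ux; exact: open_nbhs_nbhs. Qed.

Lemma near_open_eq U f g x : open U -> (forall y, U y -> f y = g y) -> U x ->
  \forall y \near x, f y = g y.
Proof.
move=> oU fg Ux; near=> y; apply: fg; near: y; exact: near_open.
Unshelve. all: by end_near. Qed.

Lemma Ck_eq k U f g : open U -> (forall x, U x -> f x = g x) ->
  Ck k U f -> Ck k U g.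
Proof.
move=> oU; elim: k f g => [|k IH] f g fg /=.
  move=> cf x Ux; have fgx := near_open_eq oU fg Ux.
  have gfx : {near nbhs x, f =1 g} by [].
  rewrite /prop_for /continuous_at -(fg x Ux).
  exact: cvg_trans (near_eq_cvg gfx) (cf x Ux).
move=> [df Df]; split=> [x Ux|v].
  by apply: near_eq_differentiable (df x Ux); exact: (near_open_eq oU fg Ux).
by apply: IH (Df v) => x Ux; apply: near_eq_derive; exact: (near_open_eq oU fg Ux).
Unshelve. all: by end_near. Qed.

Lemma Cinfty_eq U f g : open U -> (forall x, U x -> f x = g x) ->
  Cinfty U f -> Cinfty U g.
Proof. by move=> oU fg sf k; apply: Ck_eq (sf k). Qed.

Lemma Ck_sub k U W f : W `<=` U -> Ck k U f -> Ck k W f.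
Proof.
move=> WU; elim: k f => [|k IH] f /=; first by move=> cf x /WU/cf.
by move=> [df Df]; split=> [x /WU/df //|v]; exact: IH.
Qed.

Lemma Cinfty_sub U W f : W `<=` U -> Cinfty U f -> Cinfty W f.
Proof. by move=> WU sf k; apply: Ck_sub (sf k). Qed.

Lemma Cinfty_differentiable U f x : Cinfty U f -> U x -> differentiable f x.
Proof. by move=> /(_ 1%N) [+ _]; apply. Qed.

Lemma Cinfty_derive U f v : Cinfty U f -> Cinfty U ('D_v f).
Proof. by move=> sf k; have [_] := sf k.+1; apply. Qed.

Lemma Cinfty_derivable U f v x : Cinfty U f -> U x -> derivable f x v.
Proof. by move=> sf Ux; apply/diff_derivable/(Cinfty_differentiable sf). Qed.

Lemma Cinfty_cst U (a : R) : Cinfty U (fun=> a).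
Proof.
move=> k; elim: k a => [|k IH] a; first by move=> x _; exact: cst_continuous.
split=> [x _|v]; first exact: differentiable_cst.
suff -> : 'D_v (cst a) = cst (0 : R) by exact: IH.
by apply/funext => x; rewrite derive_cst.
Qed.

Lemma CkD k U f g : open U -> Ck k U f -> Ck k U g -> Ck k U (f + g).
Proof.
move=> oU; elim: k f g => [|k IH] f g /=.
  by move=> cf cg x Ux; exact: (cvgD (cf x Ux) (cg x Ux)).
move=> [df Df] [dg Dg]; split=> [x Ux|v].
  by apply: differentiableD; [exact: df|exact: dg].
apply: Ck_eq (IH _ _ (Df v) (Dg v)) => // x Ux; rewrite deriveD //.
  exact/diff_derivable/df.
exact/diff_derivable/dg.
Qed.

Lemma CinftyD U f g : open U -> Cinfty U f -> Cinfty U g -> Cinfty U (f + g).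
Proof. by move=> oU sf sg k; exact: CkD. Qed.

Lemma Ck_pred k U f : Ck k.+1 U f -> Ck k U f.
Proof.
elim: k f => [|k IH] f; last by move=> [df Df]; split=> // v; exact: IH.
by move=> [df _] x Ux; exact/differentiable_continuous/df.
Qed.

Lemma CkM k U f g : open U -> Ck k U f -> Ck k U g -> Ck k U (f * g).
Proof.
move=> oU; elim: k f g => [|k IH] f g.
  by move=> cf cg x Ux; exact: (cvgM (cf x Ux) (cg x Ux)).
move=> sf sg; have [df Df] := sf; have [dg Dg] := sg; split=> [x Ux|v].
  by apply: differentiableM; [exact: df|exact: dg].
(* In the Leibniz rule each derivative is multiplied by an undifferentiated factor, whose class is
   lowered from [k.+1] to [k]. *)
have := CkD oU (IH _ _ (Ck_pred sf) (Dg v)) (IH _ _ (Ck_pred sg) (Df v)).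
apply: Ck_eq => // x Ux; rewrite deriveM //.
  exact/diff_derivable/df.
exact/diff_derivable/dg.
Qed.

Lemma CinftyM U f g : open U -> Cinfty U f -> Cinfty U g -> Cinfty U (f * g).
Proof. by move=> oU sf sg k; exact: CkM. Qed.

(** The derivative of 1/f is - f^-2 times that of f, so the order can be raised with [f] fixed: the
    factors f^-1 have the class given by the induction hypothesis. *)
Lemma CinftyV U f : open U -> (forall x, U x -> f x != 0) -> Cinfty U f ->
  Cinfty U (fun x => (f x)^-1).
Proof.
move=> oU f0 sf.
have dV x : U x -> differentiable (fun x => (f x)^-1) x.
  move=> Ux; apply: differentiableV; last exact: f0.
  exact: (Cinfty_differentiable sf).
move=> k; elim: k => [|k IH].
  by move=> x Ux; exact/differentiable_continuous/dV.
split=> // v.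
have CkV2 : Ck k U ((cst (-1) * ((fun x => (f x)^-1) * (fun x => (f x)^-1))) * 'D_v f).
  apply: CkM => //; last exact: (Cinfty_derive v sf).
  apply: CkM => //; last exact: CkM.
  exact: (Cinfty_cst U (-1)).
apply: Ck_eq CkV2 => // x Ux.
rewrite (deriveV (f0 x Ux) (Cinfty_derivable sf Ux)).
by rewrite !fctE -exprVn expr2 mulN1r.
Qed.

Lemma derive_coord (i : 'I_d) (x v : E) : 'D_v (fun y : E => y 0 i) x = v 0 i.
Proof.
have := @derive_mx R E 1 d id x v (@derivable_id R E x v).
by rewrite derive_id => /matrixP/(_ 0 i); rewrite mxE.
Qed.

End Smooth.

(** * Chain rule and composition of smooth maps *)

Section SmoothComp.
Context {R : realType} {d e : nat}.
Implicit Types (F : 'rV[R]_e -> R) (T : 'rV[R]_d -> 'rV[R]_e).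

Lemma row_differentiable T x :
  (forall i, differentiable (fun y => T y 0 i) x) -> differentiable T x.
Proof.
move=> dT; have -> : T = \sum_i (fun y => T y 0 i *: 'e_i).
  by apply/funext => y; rewrite fct_sumE {1}[T y]row_sum_delta.
by apply: differentiable_sum => i; exact: differentiableZl.
Qed.

Lemma derive_comp F T x v : differentiable F (T x) ->
  (forall i, differentiable (fun y => T y 0 i) x) ->
  'D_v (F \o T) x = 'D_(\row_i 'D_v (fun y => T y 0 i) x) F (T x).
Proof.
move=> dF dTi; have dT := row_differentiable dTi.
have <- : 'd T x v = \row_i 'D_v (fun y => T y 0 i) x.
  rewrite -deriveE // derive_mx; last exact: diff_derivable.
  by apply/rowP => i; rewrite !mxE.
have dFT : differentiable (F \o T) x by exact: differentiable_comp.
by rewrite (deriveE v dFT) (diff_comp dT dF) [RHS](deriveE _ dF).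
Qed.

Lemma derive_sum_coord F x v : differentiable F x ->
  'D_v F x = \sum_i v 0 i * 'D_('e_i) F x.
Proof.
move=> dF; rewrite deriveE // {1}[v]row_sum_delta linear_sum.
by apply: eq_bigr => i _; rewrite linearZ deriveE.
Qed.

Lemma derive_linear F x (a : R) u v : differentiable F x ->
  'D_(a *: u + v) F x = a * 'D_u F x + 'D_v F x.
Proof. by move=> dF; rewrite !deriveE // linearP. Qed.

(** The derivative of F o T is the sum of D_v T_i times (D_{e_i} F) o T, which again contains
    compositions with T; hence the induction runs over all [F] at once. *)
Lemma Cinfty_comp U W F T : open U -> open W ->
  (forall x, U x -> W (T x)) -> Cinfty W F ->
  (forall i, Cinfty U (fun y => T y 0 i)) -> Cinfty U (F \o T).
Proof.
move=> oU oW UW sF sT k; elim: k F sF => [|k IH] F sF.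
  move=> x Ux; apply/differentiable_continuous/differentiable_comp.
    by apply: row_differentiable => i; exact: (Cinfty_differentiable (sT i)).
  exact: (Cinfty_differentiable sF (UW _ Ux)).
have dT x i : U x -> differentiable (fun y => T y 0 i) x.
  exact: (Cinfty_differentiable (sT i)).
split=> [x Ux|v].
  apply: differentiable_comp.
    by apply: row_differentiable => i; exact: dT.
  exact: (Cinfty_differentiable sF (UW _ Ux)).
have Ck_term i : Ck k U ((fun x => 'D_v (fun y => T y 0 i) x) * ('D_('e_i) F \o T)).
  apply: CkM => //; first exact: (Cinfty_derive v (sT i)).
  exact: (IH _ (Cinfty_derive _ sF)).
have : Ck k U (\sum_i
    ((fun x => 'D_v (fun y => T y 0 i) x) * ('D_('e_i) F \o T))).
  elim/big_ind : _ => // [|f g]; [exact: Cinfty_cst|exact: CkD].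
apply: Ck_eq => // x Ux; rewrite fct_sumE derive_comp; first last.
- by move=> i; exact: dT.
- exact: (Cinfty_differentiable sF (UW _ Ux)).
rewrite derive_sum_coord; last exact: (Cinfty_differentiable sF (UW _ Ux)).
by apply: eq_bigr => i _; rewrite mxE !fctE.
Qed.

End SmoothComp.

(** * Smooth functions, tangent vectors and vector fields on a manifold *)

Section ManifoldBasics.
Context {R : realType} {d : nat} (N : manifold R d).
Local Notation V := (functional N R).
Implicit Types (p q : N) (u v w : V) (X Y Z : N -> V) (U W : set N)
  (f : N -> R) (a b : chart R d N) (y z : 'rV[R]_d).

Lemma chart_image_open a W : open W -> open (cfun a @` (W `&` cdom a)).
Proof.
move=> oW; rewrite openE => _ [q [Wq aq] <-]; rewrite /interior /=.
have iq : (cfun a @` cdom a) (cfun a q) by exists q.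
have cq := cinv_cont iq.
have nW : \forall z \near cfun a q, W (cinv a z).
  apply: cq; rewrite cfunK //; exact: open_nbhs_nbhs.
have ni : \forall z \near cfun a q, (cfun a @` cdom a) z.
  by apply: open_nbhs_nbhs; split => //; exact: cimg_open.
near=> z; have [r ar rz] : (cfun a @` cdom a) z by near: z.
exists r => //; split => //; rewrite -(cfunK ar) rz; near: z; exact: nW.
Unshelve. all: by end_near. Qed.

Lemma near_cinv a p (Q : N -> Prop) : cdom a p ->
  (\forall q \near p, Q q) -> \forall z \near cfun a p, Q (cinv a z).
Proof.
move=> ap nQ; have iq : (cfun a @` cdom a) (cfun a p) by exists p.
by apply: (cinv_cont iq); rewrite cfunK.
Qed.

Lemma near_cdom a p : cdom a p -> \forall q \near p, cdom a q.
Proof.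
by move=> ap; apply: open_nbhs_nbhs; split => //; exact: cdom_open.
Qed.

Lemma near_cimg a p : cdom a p ->
  \forall z \near cfun a p, cfun a (cinv a z) = z.
Proof.
move=> ap; have ni : \forall z \near cfun a p, (cfun a @` cdom a) z.
  by apply: open_nbhs_nbhs; split; [exact: cimg_open|exists p].
by apply: filterS ni => _ [q aq <-]; rewrite cfunK.
Qed.

Lemma smooth_on_sub U W f : W `<=` U -> smooth_on U f -> smooth_on W f.
Proof.
move=> WU sf a Na; apply: Cinfty_sub (sf a Na).
by move=> _ [q [/WU Uq aq] <-]; exists q.
Qed.

Lemma smooth_on_eq U f g : open U -> (forall q, U q -> f q = g q) ->
  smooth_on U f -> smooth_on U g.
Proof.
move=> oU fg sf a Na; apply: Cinfty_eq (sf a Na).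
  exact: chart_image_open.
by move=> _ [q [Uq aq] <-]; rewrite cfunK // fg.
Qed.

Lemma smooth_on_cst U (c : R) : smooth_on U (fun _ : N => c).
Proof. by move=> a Na; exact: Cinfty_cst. Qed.

Lemma smooth_onD U f g : open U -> smooth_on U f -> smooth_on U g ->
  smooth_on U (fun q => f q + g q).
Proof.
move=> oU sf sg a Na; apply: (CinftyD _ (sf a Na) (sg a Na)).
exact: chart_image_open.
Qed.

Lemma smooth_onM U f g : open U -> smooth_on U f -> smooth_on U g ->
  smooth_on U (fun q => f q * g q).
Proof.
move=> oU sf sg a Na; apply: (CinftyM _ (sf a Na) (sg a Na)).
exact: chart_image_open.
Qed.

Lemma smooth_onV U f : open U -> (forall q, U q -> f q != 0) ->
  smooth_on U f -> smooth_on U (fun q => (f q)^-1).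
Proof.
move=> oU f0 sf a Na; apply: (CinftyV _ _ (sf a Na)).
  exact: chart_image_open.
by move=> _ [q [Uq aq] <-]; rewrite cfunK ?f0.
Qed.

(** One chart containing [W] is enough: any other chart expression is obtained by composing with a
    smooth transition map. *)
Lemma smooth_on_chart a W f : @atlas R d N a -> open W -> W `<=` cdom a ->
  Cinfty (cfun a @` W) (fun y => f (cinv a y)) -> smooth_on W f.
Proof.
move=> Na oW Wa sf b Nb.
pose T (y : 'rV[R]_d) := cfun a (cinv b y).
apply: (@Cinfty_eq _ _ _ ((fun y => f (cinv a y)) \o T)).
- exact: chart_image_open.
- by move=> _ [q [Wq bq] <-]; rewrite /T /= !cfunK //; exact: Wa.
apply: (@Cinfty_comp _ _ _ _ (cfun a @` W)) => //.
- exact: chart_image_open.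
- rewrite (_ : W = W `&` cdom a); first exact: chart_image_open.
  by apply/esym/setIidl.
- by move=> _ [q [Wq bq] <-]; rewrite /T cfunK //; exists q.
- move=> i; apply: Cinfty_sub (atlas_smooth Nb Na i).
  by move=> _ [q [Wq bq] <-]; exists q => //; split=> //; exact: Wa.
Qed.

Lemma smooth_near_eq p f g : (\forall q \near p, f q = g q) ->
  smooth_near p f -> smooth_near p g.
Proof.
rewrite /prop_near1 nbhsE => -[U [oU Up] fg] [W [oW Wp] sf].
exists (U `&` W); first by split; [exact: openI|].
apply: (@smooth_on_eq _ f); first exact: openI.
  by move=> q [/fg].
by apply: smooth_on_sub sf; exact: subIsetr.
Qed.

Lemma smooth_near_cst p (c : R) : smooth_near p (fun _ : N => c).
Proof. by exists setT; [split=> //; exact: openT|exact: smooth_on_cst]. Qed.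

Lemma smooth_nearD p f g : smooth_near p f -> smooth_near p g ->
  smooth_near p (fun q => f q + g q).
Proof.
move=> [U [oU Up] sf] [W [oW Wp] sg].
exists (U `&` W); first by split; [exact: openI|].
apply: smooth_onD; first exact: openI.
  by apply: smooth_on_sub sf; exact: subIsetl.
by apply: smooth_on_sub sg; exact: subIsetr.
Qed.

Lemma smooth_nearM p f g : smooth_near p f -> smooth_near p g ->
  smooth_near p (fun q => f q * g q).
Proof.
move=> [U [oU Up] sf] [W [oW Wp] sg].
exists (U `&` W); first by split; [exact: openI|].
apply: smooth_onM; first exact: openI.
  by apply: smooth_on_sub sf; exact: subIsetl.
by apply: smooth_on_sub sg; exact: subIsetr.
Qed.

Lemma smooth_nearN p f : smooth_near p f -> smooth_near p (fun q => - f q).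
Proof.
move=> sf; have := smooth_nearM (smooth_near_cst p (-1)) sf.
by apply: smooth_near_eq; apply: nearW => q; rewrite mulN1r.
Qed.

Lemma smooth_nearB p f g : smooth_near p f -> smooth_near p g ->
  smooth_near p (fun q => f q - g q).
Proof. by move=> sf sg; apply: smooth_nearD => //; exact: smooth_nearN. Qed.

Lemma smooth_nearV p f : (\forall q \near p, f q != 0) -> smooth_near p f ->
  smooth_near p (fun q => (f q)^-1).
Proof.
rewrite /prop_near1 nbhsE => -[U [oU Up] f0] [W [oW Wp] sf].
exists (U `&` W); first by split; [exact: openI|].
apply: smooth_onV; first exact: openI.
  by move=> q [/f0].
by apply: smooth_on_sub sf; exact: subIsetr.
Qed.

Lemma smooth_near_near p f : smooth_near p f ->
  \forall q \near p, smooth_near q f.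
Proof.
move=> [U [oU Up] sf]; apply: filterS (open_nbhs_nbhs (conj oU Up)) => q Uq.
by exists U.
Qed.

Lemma smooth_near_differentiable a p f : @atlas R d N a -> cdom a p ->
  smooth_near p f -> differentiable (fun z => f (cinv a z)) (cfun a p).
Proof.
move=> Na ap [U [oU Up] sf]; apply: (Cinfty_differentiable (sf a Na)).
by exists p.
Qed.

Lemma dir_derivE a p y f : smooth_near p f ->
  dir_deriv a p y f = 'D_y (fun z => f (cinv a z)) (cfun a p).
Proof. by move=> sf; rewrite /dir_deriv asboolT. Qed.

Lemma dir_deriv_out a p y f : ~ smooth_near p f -> dir_deriv a p y f = 0.
Proof. by move=> sf; rewrite /dir_deriv asboolF. Qed.

Lemma dir_deriv_lin a p (s : R) y z : @atlas R d N a -> cdom a p ->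
  dir_deriv a p (s *: y + z) = s *: dir_deriv a p y + dir_deriv a p z.
Proof.
move=> Na ap; apply/funext => f; rewrite !fctE.
have [sf|sf] := pselect (smooth_near p f).
  by rewrite !dir_derivE // derive_linear //; exact: smooth_near_differentiable.
by rewrite !dir_deriv_out // scaler0 addr0.
Qed.

(** The Jacobian at p of the transition map from [a] to [b], applied to [y]. *)
Definition chart_jac a b p y : 'rV[R]_d :=
  \row_i 'D_y (fun z => cfun b (cinv a z) 0 i) (cfun a p).

Lemma dir_deriv_change a b p y : @atlas R d N a -> @atlas R d N b ->
  cdom a p -> cdom b p -> dir_deriv a p y = dir_deriv b p (chart_jac a b p y).
Proof.
move=> Na Nb ap bp; apply/funext => f.
have [sf|sf] := pselect (smooth_near p f); last by rewrite !dir_deriv_out.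
rewrite !dir_derivE //.
have -> : 'D_y (fun z => f (cinv a z)) (cfun a p) =
  'D_y ((fun z => f (cinv b z)) \o (fun z => cfun b (cinv a z))) (cfun a p).
  apply: near_eq_derive; have := near_cinv ap (near_cdom bp).
  by apply: filterS => z bz /=; rewrite cfunK.
have jp : cfun b (cinv a (cfun a p)) = cfun b p by rewrite cfunK.
rewrite derive_comp /= ?jp //; first exact: smooth_near_differentiable.
move=> i; apply: (Cinfty_differentiable (atlas_smooth Na Nb i)).
by exists p.
Qed.

(** A tangent vector comes with some unknown chart; the Jacobian carries it to any prescribed one,
    so that two vectors at p can be compared in the same coordinates. *)
Lemma tangentP a p u : @atlas R d N a -> cdom a p ->
  tangent p u <-> exists y, u = dir_deriv a p y.
Proof.
move=> Na ap; split=> [[b [y [Nb bp ->]]]|[y ->]]; last by exists a, y.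
by exists (chart_jac b a p y); exact: dir_deriv_change.
Qed.

Lemma tangent_lin p (s : R) u v : tangent p u -> tangent p v ->
  tangent p (s *: u + v).
Proof.
have [a Na ap] := atlas_cover p.
move=> /(tangentP _ Na ap)[y ->] /(tangentP _ Na ap)[z ->].
by apply/(tangentP _ Na ap); exists (s *: y + z); rewrite dir_deriv_lin.
Qed.

Lemma tangent0 p : tangent p (0 : V).
Proof.
have [a Na ap] := atlas_cover p; apply/(tangentP _ Na ap); exists 0.
have := @dir_deriv_lin a p (-1) 0 0 Na ap.
by rewrite scaler0 addr0 scaleN1r addNr.
Qed.

Lemma tangentZ p (s : R) u : tangent p u -> tangent p (s *: u).
Proof.
by move=> tu; rewrite -[s *: u]addr0; apply: tangent_lin => //; exact: tangent0.
Qed.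

Lemma tangentD p u v : tangent p u -> tangent p v -> tangent p (u + v).
Proof. by move=> tu tv; rewrite -[u]scale1r; exact: tangent_lin. Qed.

Lemma tangentN p u : tangent p u -> tangent p (- u).
Proof. by move=> tu; rewrite -scaleN1r; exact: tangentZ. Qed.

Lemma tangentB p u v : tangent p u -> tangent p v -> tangent p (u - v).
Proof. by move=> tu tv; apply: tangentD => //; exact: tangentN. Qed.

Lemma tangent_sum p (I : Type) (r : seq I) (F : I -> V) :
  (forall i, tangent p (F i)) -> tangent p (\sum_(i <- r) F i).
Proof.
move=> tF; elim/big_ind : _ => // [|u v]; [exact: tangent0|exact: tangentD].
Qed.

(** Smoothness is not assumed: being smooth near p depends on the germ only, so the value 0 on
    non-smooth functions is taken on both sides or on neither. *)
Lemma tangent_near_eq p u f g : tangent p u -> (\forall q \near p, f q = g q) ->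
  u f = u g.
Proof.
move=> [a [y [Na ap ->]]] fg.
have gf : \forall q \near p, g q = f q by apply: filterS fg => q ->.
have [sf|sf] := pselect (smooth_near p f); last first.
  by rewrite !dir_deriv_out // => sg; exact: (sf (smooth_near_eq gf sg)).
rewrite !dir_derivE //; last exact: (smooth_near_eq fg sf).
by apply: near_eq_derive; exact: (near_cinv ap fg).
Qed.

Lemma tangent_fctD p u f g : tangent p u -> smooth_near p f ->
  smooth_near p g -> u (fun q => f q + g q) = u f + u g.
Proof.
move=> [a [y [Na ap ->]]] sf sg; rewrite !dir_derivE //; last exact: smooth_nearD.
have df := smooth_near_differentiable Na ap sf.
have dg := smooth_near_differentiable Na ap sg.
exact: (deriveD (diff_derivable df) (diff_derivable dg)).
Qed.

Lemma tangent_cst p u (c : R) : tangent p u -> u (fun=> c) = 0.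
Proof.
move=> [a [y [Na ap ->]]]; rewrite dir_derivE; last exact: smooth_near_cst.
exact: derive_cst.
Qed.

Lemma tangent_fctM p u f g : tangent p u -> smooth_near p f ->
  smooth_near p g -> u (fun q => f q * g q) = f p * u g + g p * u f.
Proof.
move=> [a [y [Na ap ->]]] sf sg; rewrite !dir_derivE //; last exact: smooth_nearM.
have df := smooth_near_differentiable Na ap sf.
have dg := smooth_near_differentiable Na ap sg.
rewrite (deriveM (diff_derivable df) (diff_derivable dg)) cfunK //.
Qed.

Lemma tangent_fctZ p u (c : R) f : tangent p u -> smooth_near p f ->
  u (fun q => c * f q) = c * u f.
Proof.
move=> tu sf; rewrite (tangent_fctM tu (smooth_near_cst p c) sf).
by rewrite (tangent_cst _ tu) mulr0 addr0.
Qed.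

Lemma tangent_fctN p u f : tangent p u -> smooth_near p f ->
  u (fun q => - f q) = - u f.
Proof.
move=> tu sf; rewrite -mulN1r -(tangent_fctZ _ tu sf).
by congr (u _); apply/funext => q; rewrite mulN1r.
Qed.

Lemma tangent_fctB p u f g : tangent p u -> smooth_near p f ->
  smooth_near p g -> u (fun q => f q - g q) = u f - u g.
Proof.
move=> tu sf sg; rewrite -(tangent_fctN tu sg).
exact: (tangent_fctD tu sf (smooth_nearN sg)).
Qed.

Lemma coord_smooth a (i : 'I_d) : @atlas R d N a ->
  smooth_on (cdom a) (fun q => cfun a q 0 i).
Proof.
move=> Na b Nb; apply: Cinfty_sub (atlas_smooth Nb Na i).
by move=> _ [q [aq bq] <-]; exists q.
Qed.

Lemma coord_smooth_near a p (i : 'I_d) : @atlas R d N a -> cdom a p ->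
  smooth_near p (fun q => cfun a q 0 i).
Proof.
by move=> Na ap; exists (cdom a); [split=> //; exact: cdom_open|exact: coord_smooth].
Qed.

Lemma dir_deriv_coord a p y (i : 'I_d) : @atlas R d N a -> cdom a p ->
  dir_deriv a p y (fun q => cfun a q 0 i) = y 0 i.
Proof.
move=> Na ap; rewrite dir_derivE; last exact: coord_smooth_near.
rewrite (@near_eq_derive _ _ _ _ (fun z : 'rV[R]_d => z 0 i)); last first.
  by apply: filterS (near_cimg ap) => z ->.
exact: derive_coord.
Qed.

Lemma dir_deriv_eq0 a p y : @atlas R d N a -> cdom a p ->
  dir_deriv a p y = 0 -> y = 0.
Proof.
move=> Na ap y0; apply/rowP => i; rewrite mxE -(dir_deriv_coord y i Na ap).
by rewrite y0.
Qed.

Lemma coord_field a y : @atlas R d N a ->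
  vector_field (cdom a) (fun q => dir_deriv a q y).
Proof.
move=> Na; split; first exact: cdom_open.
  by move=> q aq; exists a, y.
move=> W f oW Wa sf; apply: (smooth_on_chart Na oW Wa).
have Wc : W `&` cdom a = W by apply/setIidl.
apply: (@Cinfty_eq _ _ _ ('D_y (fun z => f (cinv a z)))).
- by rewrite -Wc; exact: chart_image_open.
- move=> _ [q Wq <-]; have aq := Wa _ Wq; rewrite cfunK // dir_derivE //.
  by exists W.
- by apply: Cinfty_derive; rewrite -Wc; exact: sf.
Qed.

Lemma vf_sub U W X : open W -> W `<=` U -> vector_field U X -> vector_field W X.
Proof.
move=> oW WU [oU tX sX]; split=> // [q /WU|W' f oW' W'W]; first exact: tX.
by apply: sX => //; exact: subset_trans WU.
Qed.

Lemma vf_eq U X Y : (forall q, U q -> X q = Y q) -> vector_field U X ->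
  vector_field U Y.
Proof.
move=> XY [oU tX sX]; split=> // [q Uq|W f oW WU sf].
  by rewrite -XY //; exact: tX.
apply: smooth_on_eq (sX W f oW WU sf) => // q /WU Uq; by rewrite XY.
Qed.

Lemma vfD U X Y : vector_field U X -> vector_field U Y ->
  vector_field U (fun q => X q + Y q).
Proof.
move=> [oU tX sX] [_ tY sY]; split=> // [q Uq|W f oW WU sf].
  by apply: tangentD; [exact: tX|exact: tY].
exact: (smooth_onD oW (sX W f oW WU sf) (sY W f oW WU sf)).
Qed.

Lemma vfZ U f X : smooth_on U f -> vector_field U X ->
  vector_field U (fun q => f q *: X q).
Proof.
move=> sf [oU tX sX]; split=> // [q Uq|W f' oW WU sf'].
  by apply: tangentZ; exact: tX.
apply: (smooth_onM oW _ (sX W f' oW WU sf')).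
exact: smooth_on_sub sf.
Qed.

Lemma vfn_tangent p X : vector_field_near p X -> tangent p (X p).
Proof. by move=> [U [oU Up] [_ tX _]]; exact: tX. Qed.

Lemma vfn_near p X : vector_field_near p X ->
  \forall q \near p, vector_field_near q X.
Proof.
move=> [U [oU Up] vX]; apply: filterS (open_nbhs_nbhs (conj oU Up)) => q Uq.
by exists U.
Qed.

Lemma vfn_common p X Y : vector_field_near p X -> vector_field_near p Y ->
  exists U, [/\ open U, U p, vector_field U X & vector_field U Y].
Proof.
move=> [U [oU Up] vX] [W [oW Wp] vY]; exists (U `&` W); split=> //.
- exact: openI.
- by apply: vf_sub vX; [exact: openI|exact: subIsetl].
- by apply: vf_sub vY; [exact: openI|exact: subIsetr].
Qed.

Lemma vfn_smooth p X f : vector_field_near p X -> smooth_near p f ->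
  smooth_near p (fun q => X q f).
Proof.
move=> [U [oU Up] [_ _ sX]] [W [oW Wp] sf].
exists (U `&` W); first by split; [exact: openI|].
apply: sX; [exact: openI|exact: subIsetl|].
by apply: smooth_on_sub sf; exact: subIsetr.
Qed.

Lemma vfn_eq p X Y : (\forall q \near p, X q = Y q) ->
  vector_field_near p X -> vector_field_near p Y.
Proof.
rewrite /prop_near1 nbhsE => -[U [oU Up] XY] [W [oW Wp] vX].
exists (U `&` W); first by split; [exact: openI|].
apply: (@vf_eq _ X); first by move=> q [/XY].
by apply: vf_sub vX; [exact: openI|exact: subIsetr].
Qed.

Lemma vfnD p X Y : vector_field_near p X -> vector_field_near p Y ->
  vector_field_near p (fun q => X q + Y q).
Proof.
by move=> vX vY; have [U [oU Up uX uY]] := vfn_common vX vY; exists U => //;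
  exact: vfD.
Qed.

Lemma vfnZ p f X : smooth_near p f -> vector_field_near p X ->
  vector_field_near p (fun q => f q *: X q).
Proof.
move=> [W [oW Wp] sf] [U [oU Up] vX].
exists (U `&` W); first by split; [exact: openI|].
apply: vfZ; first by apply: smooth_on_sub sf; exact: subIsetr.
by apply: vf_sub vX; [exact: openI|exact: subIsetl].
Qed.

Lemma vfnN p X : vector_field_near p X -> vector_field_near p (fun q => - X q).
Proof.
move=> /(vfnZ (smooth_near_cst p (-1))); apply: vfn_eq.
by apply: nearW => q; rewrite scaleN1r.
Qed.

Lemma vfnB p X Y : vector_field_near p X -> vector_field_near p Y ->
  vector_field_near p (fun q => X q - Y q).
Proof. by move=> vX vY; apply: vfnD => //; exact: vfnN. Qed.

Lemma vfn0 p : vector_field_near p (fun _ : N => 0 : V).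
Proof.
have [a Na ap] := atlas_cover p.
have va : vector_field_near p (fun q => dir_deriv a q 0).
  by exists (cdom a); [split=> //; exact: cdom_open|exact: coord_field].
have := vfnZ (smooth_near_cst p 0) va; apply: vfn_eq.
by apply: nearW => q; rewrite scale0r.
Qed.

Lemma vfn_exists p u : tangent p u ->
  exists2 Y, vector_field_near p Y & Y p = u.
Proof.
move=> [a [y [Na ap ->]]]; exists (fun q => dir_deriv a q y) => //.
by exists (cdom a); [split=> //; exact: cdom_open|exact: coord_field].
Qed.

End ManifoldBasics.

#[local] Hint Resolve tangent0 tangentZ tangentD tangentN tangentB : tg.

(** * Bilinearity and positivity of the metric on tangent vectors *)

Section Metric.
Context {R : realType} {d : nat} (N : manifold R d).
Local Notation V := (functional N R).
Context (g : N -> V -> V -> R) (gP : riemannian_metric g).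
Implicit Types (p q : N) (u v w : V) (X Y Z : N -> V).

Lemma metricC p u v : tangent p u -> tangent p v -> g p u v = g p v u.
Proof. by case: gP => _ + _ _; apply. Qed.

Lemma metricPl p (s : R) u v w : tangent p u -> tangent p v -> tangent p w ->
  g p (s *: u + v) w = s * g p u w + g p v w.
Proof. by case: gP => + _ _ _; apply. Qed.

Lemma metric0l p w : tangent p w -> g p 0 w = 0.
Proof.
move=> tw; have := metricPl (-1) (tangent0 p) (tangent0 p) tw.
by rewrite scaler0 addr0 mulN1r addNr.
Qed.

Lemma metricZl p (s : R) u w : tangent p u -> tangent p w ->
  g p (s *: u) w = s * g p u w.
Proof.
by move=> tu tw; rewrite -[s *: u]addr0 metricPl ?metric0l ?addr0 //; exact: tangent0.
Qed.

Lemma metricDl p u v w : tangent p u -> tangent p v -> tangent p w ->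
  g p (u + v) w = g p u w + g p v w.
Proof. by move=> tu tv tw; rewrite -[u]scale1r metricPl // scale1r mul1r. Qed.

Lemma metricNl p u w : tangent p u -> tangent p w -> g p (- u) w = - g p u w.
Proof. by move=> tu tw; rewrite -scaleN1r metricZl // mulN1r. Qed.

Lemma metricBl p u v w : tangent p u -> tangent p v -> tangent p w ->
  g p (u - v) w = g p u w - g p v w.
Proof. by move=> tu tv tw; rewrite metricDl ?metricNl //; exact: tangentN. Qed.

Lemma metric0r p w : tangent p w -> g p w 0 = 0.
Proof. by move=> tw; rewrite metricC ?metric0l //; exact: tangent0. Qed.

Lemma metricZr p (s : R) u w : tangent p u -> tangent p w ->
  g p w (s *: u) = s * g p w u.
Proof.
by move=> tu tw; rewrite metricC ?metricZl ?(metricC tu) //; exact: tangentZ.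
Qed.

Lemma metricDr p u v w : tangent p u -> tangent p v -> tangent p w ->
  g p w (u + v) = g p w u + g p w v.
Proof.
move=> tu tv tw.
by rewrite metricC ?metricDl ?(metricC tu) ?(metricC tv) //; exact: tangentD.
Qed.

Lemma metricNr p u w : tangent p u -> tangent p w -> g p w (- u) = - g p w u.
Proof. by move=> tu tw; rewrite -scaleN1r metricZr // mulN1r. Qed.

Lemma metricBr p u v w : tangent p u -> tangent p v -> tangent p w ->
  g p w (u - v) = g p w u - g p w v.
Proof. by move=> tu tv tw; rewrite metricDr ?metricNr //; exact: tangentN. Qed.

Lemma metric_suml p (I : Type) (r : seq I) (F : I -> V) w :
  (forall i, tangent p (F i)) -> tangent p w ->
  g p (\sum_(i <- r) F i) w = \sum_(i <- r) g p (F i) w.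
Proof.
move=> tF tw; elim: r => [|i r IH]; first by rewrite !big_nil metric0l.
by rewrite !big_cons metricDl ?IH //; exact: tangent_sum.
Qed.

Lemma metric_sumr p (I : Type) (r : seq I) (F : I -> V) w :
  (forall i, tangent p (F i)) -> tangent p w ->
  g p w (\sum_(i <- r) F i) = \sum_(i <- r) g p w (F i).
Proof.
move=> tF tw; rewrite metricC ?metric_suml //; last exact: tangent_sum.
by apply: eq_bigr => i _; exact: metricC.
Qed.

Lemma metric_ge0 p u : tangent p u -> 0 <= g p u u.
Proof.
move=> tu; have [->|u0] := eqVneq u 0; first by rewrite metric0l //; exact: tangent0.
by case: gP => _ _ + _ => /(_ p u tu u0)/ltW.
Qed.

Lemma metric_eq0 p u : tangent p u -> g p u u = 0 -> u = 0.
Proof.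
move=> tu gu; apply/eqP/negPn/negP => u0.
by case: gP => _ _ + _ => /(_ p u tu u0); rewrite gu ltxx.
Qed.

Lemma metric_smooth p X Y : vector_field_near p X -> vector_field_near p Y ->
  smooth_near p (fun q => g q (X q) (Y q)).
Proof.
move=> vX vY; have [U [oU Up uX uY]] := vfn_common vX vY.
by exists U => //; case: gP => _ _ _; exact.
Qed.

End Metric.

(** * Tangent spaces of a submanifold and the projection onto them *)

Section SliceCharts.
Context {R : realType} {d : nat} (N : manifold R d).
Local Notation V := (functional N R).
Context (n : nat) (M : set N).
Implicit Types (p q : N) (u v w : V) (X Y Z : N -> V) (a b : chart R d N).

Definition coord_span r a p : set V :=
  [set v | exists y : 'rV[R]_d,
     (forall j : 'I_d, (r <= j)%N -> y 0 j = 0) /\ v = dir_deriv a p y].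

Lemma coord_span_sub r s a p v : (r <= s)%N ->
  coord_span r a p v -> coord_span s a p v.
Proof.
by move=> rs [y [y0 ->]]; exists y; split=> // j /(leq_trans rs); exact: y0.
Qed.

Lemma coord_span_tangent r a p v : @atlas R d N a -> cdom a p ->
  coord_span r a p v -> tangent p v.
Proof. by move=> Na ap [y [_ ->]]; exists a, y. Qed.

Lemma coord_span_lin r a p (s : R) u v : @atlas R d N a -> cdom a p ->
  coord_span r a p u -> coord_span r a p v -> coord_span r a p (s *: u + v).
Proof.
move=> Na ap [y [y0 ->]] [z [z0 ->]]; exists (s *: y + z).
split; last by rewrite dir_deriv_lin.
by move=> j rj; rewrite !mxE y0 // z0 // mulr0 addr0.
Qed.

(** Let [T] set the transversal coordinates to 0. Near the point F o T vanishes, since [T] lands in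
    the slice, and by the chain rule F and F o T have the same derivative along [y], a direction
    that [T] fixes. *)
Lemma slice_deriv0 a p (y : 'rV[R]_d) f : slice_chart n M a -> cdom a p -> M p ->
  (forall j : 'I_d, (n <= j)%N -> y 0 j = 0) ->
  (\forall q \near p, M q -> f q = 0) -> dir_deriv a p y f = 0.
Proof.
move=> [Na sl] ap Mp y0 f0.
have [sf|sf] := pselect (smooth_near p f); last by rewrite dir_deriv_out.
rewrite dir_derivE //.
pose T (z : 'rV[R]_d) : 'rV[R]_d := \row_j if (n <= j)%N then 0 else z 0 j.
pose F z := f (cinv a z).
have TE z j : T z 0 j = if (n <= j)%N then 0 else z 0 j by rewrite mxE.
have Tp : T (cfun a p) = cfun a p.
  apply/rowP => j; rewrite TE; case: ifP => // nj.
  by rewrite (proj1 (sl p ap) Mp j nj).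
have dT j : differentiable (fun z => T z 0 j) (cfun a p).
  rewrite (_ : (fun z => T z 0 j) =
    if (n <= j)%N then cst 0 else (fun z : 'rV[R]_d => z 0 j)); last first.
    by apply/funext => z; rewrite TE; case: ifP.
  by case: ifP => _; [exact: differentiable_cst|exact: differentiable_coord].
have dF : differentiable F (T (cfun a p)).
  by rewrite Tp; exact: smooth_near_differentiable.
have DT : \row_j 'D_y (fun z => T z 0 j) (cfun a p) = y.
  apply/rowP => j; rewrite mxE; have [nj|nj] := boolP (n <= j)%N.
    rewrite (_ : (fun z => T z 0 j) = cst 0) ?derive_cst ?y0 //.
    by apply/funext => z; rewrite TE nj.
  rewrite (_ : (fun z => T z 0 j) = (fun z : 'rV[R]_d => z 0 j)).
    exact: derive_coord.
  by apply/funext => z; rewrite TE (negbTE nj).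
have := derive_comp y dF dT; rewrite DT Tp => <-.
have cT : {for cfun a p, continuous T}.
  exact/differentiable_continuous/row_differentiable.
(* Close to the base point, [T z] is still in the image of the chart and its transversal coordinates
   are 0, so the corresponding point lies on [M]. *)
have FT0 : \forall z \near cfun a p, F (T z) = 0.
  pose G z := [/\ cfun a (cinv a z) = z, cdom a (cinv a z) &
    M (cinv a z) -> F z = 0].
  have nG : \forall z \near T (cfun a p), G z.
    rewrite Tp; near=> z; split; near: z; first exact: near_cimg.
      exact: (near_cinv ap (near_cdom ap)).
    exact: (near_cinv ap f0).
  have nGT : \forall z \near cfun a p, G (T z) := cT _ nG.
  apply: filterS nGT => z [cz az]; apply; apply/(sl _ az) => j nj.
  by rewrite cz TE nj.
by rewrite (@near_eq_derive _ _ _ _ (cst 0)) ?derive_cst.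
Unshelve. all: by end_near. Qed.

Lemma tangent_sub_deriv0 p u f : M p -> tangent_sub n M p u ->
  (\forall q \near p, M q -> f q = 0) -> u f = 0.
Proof. by move=> Mp [a [y [sa ap y0 ->]]] f0; exact: slice_deriv0. Qed.

Lemma tangent_sub_tangent p u : tangent_sub n M p u -> tangent p u.
Proof. by move=> [a [y [[Na _] ap _ ->]]]; exists a, y. Qed.

(* Tangent vectors of M are those annihilating the transversal coordinates. *)
Lemma tangent_subP a p u : slice_chart n M a -> cdom a p -> M p ->
  tangent_sub n M p u <-> coord_span n a p u.
Proof.
move=> sa ap Mp; have [Na sl] := sa; split=> [tu|[y [y0 ->]]]; last by exists a, y.
have [y uy] := proj1 (tangentP u Na ap) (tangent_sub_tangent tu).
exists y; split=> // j nj; rewrite -(dir_deriv_coord y j Na ap) -uy.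
apply: tangent_sub_deriv0 tu _ => //.
by apply: filterS (near_cdom ap) => q aq /(sl q aq); exact.
Qed.

Hypothesis subM : submanifold n M.

Lemma tangent_sub_lin p (s : R) u v : M p -> tangent_sub n M p u ->
  tangent_sub n M p v -> tangent_sub n M p (s *: u + v).
Proof.
move=> Mp; have [_ /(_ p Mp)[a sa ap]] := subM.
move=> /(tangent_subP _ sa ap Mp) tu /(tangent_subP _ sa ap Mp) tv.
by apply/(tangent_subP _ sa ap Mp); apply: coord_span_lin => //; case: sa.
Qed.

Lemma tangent_sub0 p : M p -> tangent_sub n M p 0.
Proof.
move=> Mp; have [_ /(_ p Mp)[a [Na sl] ap]] := subM.
exists a, 0; split=> //; first by move=> j _; rewrite mxE.
have := @dir_deriv_lin _ _ N a p (-1) 0 0 Na ap.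
by rewrite scaler0 addr0 scaleN1r addNr.
Qed.

Lemma tangent_subD p u v : M p -> tangent_sub n M p u ->
  tangent_sub n M p v -> tangent_sub n M p (u + v).
Proof. by move=> Mp tu tv; rewrite -[u]scale1r; exact: tangent_sub_lin. Qed.

Lemma tangent_subZ p (s : R) u : M p -> tangent_sub n M p u ->
  tangent_sub n M p (s *: u).
Proof.
by move=> Mp tu; rewrite -[s *: u]addr0; apply: tangent_sub_lin => //;
  exact: tangent_sub0.
Qed.

Lemma tangent_subB p u v : M p -> tangent_sub n M p u ->
  tangent_sub n M p v -> tangent_sub n M p (u - v).
Proof.
by move=> Mp tu tv; rewrite addrC -scaleN1r; exact: tangent_sub_lin.
Qed.

Lemma tangent_sub_sum p (I : Type) (r : seq I) (F : I -> V) : M p ->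
  (forall i, tangent_sub n M p (F i)) -> tangent_sub n M p (\sum_(i <- r) F i).
Proof.
move=> Mp tF; elim/big_ind : _ => // [|u v]; first exact: tangent_sub0.
exact: tangent_subD.
Qed.

Lemma sub_field_exists p u : tangent_sub n M p u ->
  exists Y, sub_field_near n M p Y /\ Y p = u.
Proof.
move=> [a [y [sa ap y0 ->]]]; have [Na _] := sa.
exists (fun q => dir_deriv a q y); split=> //; split.
  by exists (cdom a); [split=> //; exact: cdom_open|exact: coord_field].
by apply: filterS (near_cdom ap) => q aq Mq; exists a, y.
Qed.

Lemma sub_extendP p u : tangent_sub n M p u ->
  sub_field_near n M p (sub_extend n M p u) /\ sub_extend n M p u p = u.
Proof. by move=> tu; exact: (xgetPex _ (sub_field_exists tu)). Qed.

Lemma sub_field_tangent p X : M p -> sub_field_near n M p X ->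
  tangent_sub n M p (X p).
Proof. by move=> Mp [_ /nbhs_singleton]; exact. Qed.

Context (g : N -> V -> V -> R) (gP : riemannian_metric g).

(* Orthogonal projection onto the span of the first r coordinate fields,
   built one Gram-Schmidt step at a time; it keeps smoothness visible. *)
Lemma coord_projection a p r Z : @atlas R d N a -> cdom a p -> (r <= d)%N ->
  vector_field_near p Z ->
  exists2 Z', vector_field_near p Z' &
    \forall q \near p, coord_span r a q (Z' q) /\
      forall w, coord_span r a q w -> g q (Z q - Z' q) w = 0.
Proof.
move=> Na ap; elim: r Z => [|r IH] Z rd vZ.
  exists (fun=> 0); first exact: vfn0.
  apply: filterS (filterI (near_cdom ap) (vfn_near vZ)) =>
    q [aq vq].
  have e0 (y : 'rV[R]_d) : (forall j : 'I_d, (0 <= j)%N -> y 0 j = 0) -> y = 0.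
    by move=> y0; apply/rowP => j; rewrite mxE y0.
  have d0 : dir_deriv a q 0 = 0.
    have := @dir_deriv_lin _ _ N a q (-1) 0 0 Na aq.
    by rewrite scaler0 addr0 scaleN1r addNr.
  split; first by exists 0; split=> // j _; rewrite mxE.
  move=> w [y [/e0 -> ->]]; rewrite d0 subr0 (metric0r gP) //.
  exact: vfn_tangent.
pose i := Ordinal rd.
pose E q := dir_deriv a q ('e_i : 'rV[R]_d).
have vE : vector_field_near p E.
  by exists (cdom a); [split=> //; exact: cdom_open|exact: coord_field].
have [E' vE' pE] := IH E (ltnW rd) vE.
have [Z1 vZ1 pZ] := IH Z (ltnW rd) vZ.
pose F q := E q - E' q.
have vF : vector_field_near p F by exact: vfnB.
(* Orthogonality is to be tested on the first r + 1 coordinate fields; subtracting the r-th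
   coordinate times [F] from a vector in their span leaves one in the span of the first r. *)
have spanE q w : cdom a q -> coord_span r a q (E' q) -> coord_span r.+1 a q w ->
    exists w' (s : R), coord_span r a q w' /\ w = w' + s *: F q.
  move=> aq [z [z0 E'q]] [y [y0 ->]].
  exists (dir_deriv a q (y 0 i *: z + (y - y 0 i *: 'e_i))), (y 0 i); split.
    exists (y 0 i *: z + (y - y 0 i *: 'e_i)); split=> // j rj.
    rewrite !mxE z0 // mulr0 add0r eqxx /=; have [<-|ij] := eqVneq i j.
      by rewrite mulr1 subrr.
    rewrite mulr0 subr0 y0 // ltn_neqAle rj andbT; apply: contra ij => /eqP ij.
    by apply/eqP/val_inj.
  rewrite /F E'q /E dir_deriv_lin // scalerBr [X in _ + X]addrC addrACA subrr add0r.
  rewrite addrC -dir_deriv_lin //; congr dir_deriv.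
  by rewrite addrC subrK.
(* [E' q] involves only coordinates below r, so the r-th coordinate of [F q] is 1 and [F q] is
   nonzero. *)
have F0 : \forall q \near p, g q (F q) (F q) != 0.
  apply: filterS (filterI (near_cdom ap) (filterI (vfn_near vF) pE)) =>
    q [aq [vq [[z [z0 E'q]] _]]].
  apply/eqP => /(metric_eq0 gP (vfn_tangent vq)); rewrite /F E'q /E => /eqP.
  rewrite subr_eq0 eq_sym -subr_eq0 => /eqP.
  rewrite addrC -scaleN1r -dir_deriv_lin // => /(dir_deriv_eq0 Na aq)/rowP/(_ i).
  rewrite !mxE z0 //= !eqxx addr0 mulr1 => /eqP.
  by rewrite oppr_eq0 oner_eq0.
pose c q := g q (Z q) (F q) * (g q (F q) (F q))^-1.
have sc : smooth_near p c.
  by apply: smooth_nearM; [|apply: smooth_nearV => //]; exact: (metric_smooth gP).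
exists (fun q => Z1 q + c q *: F q); first by apply: vfnD => //; exact: vfnZ.
near=> q.
have aq : cdom a q by near: q; exact: near_cdom.
have F0q : g q (F q) (F q) != 0 by near: q.
have vZq : vector_field_near q Z by near: q; exact: vfn_near.
have vZ1q : vector_field_near q Z1 by near: q; exact: vfn_near.
have vFq : vector_field_near q F by near: q; exact: vfn_near.
have [sE' oE] : coord_span r a q (E' q) /\
  forall w, coord_span r a q w -> g q (E q - E' q) w = 0 by near: q.
have [sZ1 oZ] : coord_span r a q (Z1 q) /\
  forall w, coord_span r a q w -> g q (Z q - Z1 q) w = 0 by near: q.
have tF := vfn_tangent vFq; have tZ := vfn_tangent vZq.
have tZ1 := vfn_tangent vZ1q.
split.
  rewrite addrC; apply: coord_span_lin => //; last exact: coord_span_sub sZ1.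
  have [z [z0 E'q]] := sE'; exists ('e_i - z); split=> [j rj|].
    rewrite !mxE z0 ?(ltnW rj) // subr0 andTb.
    by have [ij|//] := eqVneq j i; rewrite ij ltnn in rj.
  rewrite /F E'q /E -[dir_deriv a q 'e_i - _]addrC -scaleN1r -dir_deriv_lin //.
  by rewrite scaleN1r addrC.
move=> w /(spanE q w aq sE')[w' [s [sw' ->]]].
have tw' := coord_span_tangent Na aq sw'.
rewrite opprD addrA (metricBl gP) ?(metricDr gP) ?(metricZl gP) ?(metricZr gP);
  try solve [auto 6 with tg].
rewrite oZ // oE // (metricBl gP) // (metricC gP tZ1 tF) oE // subr0 add0r.
by rewrite mulr0 add0r mulrCA /c mulfVK // subrr.
Unshelve. all: by end_near. Qed.

(** At points of [M] in a slice chart, the first n coordinate fields span the tangent space of [M].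
    Projecting on their span at all points near p gives a smooth ambient field whose values on [M]
    are the tangential parts. *)
Lemma tan_field p Z : M p -> vector_field_near p Z ->
  exists2 Z', vector_field_near p Z' & \forall q \near p, M q ->
    tangent_sub n M q (Z' q) /\
    forall w, tangent_sub n M q w -> g q (Z q - Z' q) w = 0.
Proof.
move=> Mp vZ; have [nd /(_ p Mp)[a sa ap]] := subM; have [Na _] := sa.
have [Z' vZ' pZ'] := coord_projection Na ap nd vZ.
exists Z' => //; apply: filterS (filterI (near_cdom ap) pZ').
move=> q [aq [sZ' oZ']] Mq; split=> [|w]; first exact/(tangent_subP _ sa aq Mq).
by move=> /(tangent_subP _ sa aq Mq); exact: oZ'.
Qed.

(** [tan_part] is a choice; a vector to choose is found by extending [v] to a field and projecting
    that field. *)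
Lemma tan_partP p v : M p -> tangent p v ->
  tangent_sub n M p (tan_part n M g p v) /\
  forall w, tangent_sub n M p w -> g p (v - tan_part n M g p v) w = 0.
Proof.
move=> Mp /vfn_exists[Z vZ <-]; have [Z' vZ' pZ'] := tan_field Mp vZ.
have [tZ' oZ'] := nbhs_singleton pZ' Mp.
apply: (@xgetPex _ 0 [set u | tangent_sub n M p u /\
  forall w, tangent_sub n M p w -> g p (Z p - u) w = 0]).
by exists (Z' p).
Qed.

Lemma tan_part_sub p v : M p -> tangent p v ->
  tangent_sub n M p (tan_part n M g p v).
Proof. by move=> Mp tv; have [] := tan_partP Mp tv. Qed.

Lemma tan_part_tangent p v : M p -> tangent p v ->
  tangent p (tan_part n M g p v).
Proof. by move=> Mp tv; exact/tangent_sub_tangent/tan_part_sub. Qed.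

Lemma tan_part_metric p v w : M p -> tangent p v -> tangent_sub n M p w ->
  g p (tan_part n M g p v) w = g p v w.
Proof.
move=> Mp tv tw; have [_ /(_ w tw)] := tan_partP Mp tv.
rewrite (metricBl gP) //; first by move=> /eqP; rewrite subr_eq0 => /eqP.
  exact: tan_part_tangent.
exact: tangent_sub_tangent.
Qed.

Lemma tan_part_uniq p v u : M p -> tangent p v -> tangent_sub n M p u ->
  (forall w, tangent_sub n M p w -> g p u w = g p v w) ->
  tan_part n M g p v = u.
Proof.
move=> Mp tv tu ou; have tpv := tan_part_sub Mp tv.
have tw : tangent_sub n M p (tan_part n M g p v - u) by exact: tangent_subB.
apply/eqP; rewrite -subr_eq0; apply/eqP/(metric_eq0 gP (p := p)).
  exact: tangent_sub_tangent tw.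
have [ttv ttu] := (tangent_sub_tangent tpv, tangent_sub_tangent tu).
rewrite (metricBl gP) //; last exact: tangent_sub_tangent tw.
by rewrite tan_part_metric // ou // subrr.
Qed.

Lemma tan_part_lin p (s : R) u v : M p -> tangent p u -> tangent p v ->
  tan_part n M g p (s *: u + v) = s *: tan_part n M g p u + tan_part n M g p v.
Proof.
move=> Mp tu tv; apply: tan_part_uniq => //; first exact: tangent_lin.
  by apply: tangent_sub_lin => //; exact: tan_part_sub.
move=> w tw; have tw' := tangent_sub_tangent tw.
by rewrite !(metricPl gP) ?tan_part_metric //; exact: tan_part_tangent.
Qed.

Lemma tan_part_id p u : M p -> tangent_sub n M p u -> tan_part n M g p u = u.
Proof.
by move=> Mp tu; apply: tan_part_uniq => //; exact: tangent_sub_tangent.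
Qed.

Lemma along_extendP p Y Y' : vector_field_near p Y' ->
  (\forall q \near p, M q -> Y' q = Y q) ->
  vector_field_near p (along_extend M p Y) /\
  \forall q \near p, M q -> along_extend M p Y q = Y q.
Proof.
move=> vY' YY'; apply: (@xgetPex _ (fun=> 0) [set Y' | vector_field_near p Y' /\
  \forall q \near p, M q -> Y' q = Y q]).
by exists Y'.
Qed.

End SliceCharts.

(** * The Levi-Civita connection, brackets, and derivatives along a submanifold *)

Section LeviCivita.
Context {R : realType} {d : nat} (N : manifold R d).
Local Notation V := (functional N R).
Context (g : N -> V -> V -> R) (gP : riemannian_metric g).
Context (D : N -> V -> (N -> V) -> V) (lc : levi_civita g D).
Implicit Types (p q : N) (u v w : V) (X Y Z : N -> V).

Let affD : affine_connection D. Proof. by case: lc. Qed.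

Lemma lc_tangent p u Y : tangent p u -> vector_field_near p Y ->
  tangent p (D p u Y).
Proof. exact: (conn_tangent affD). Qed.

Lemma lc_metric p u Y Z : tangent p u -> vector_field_near p Y ->
  vector_field_near p Z ->
  u (fun q => g q (Y q) (Z q)) = g p (D p u Y) (Z p) + g p (Y p) (D p u Z).
Proof. by case: lc => _ _; apply. Qed.

Lemma lc_bracket p X Y : vector_field_near p X -> vector_field_near p Y ->
  bracket X Y p = D p (X p) Y - D p (Y p) X.
Proof. by case: lc => _ + _ => H vX vY; rewrite H. Qed.

Lemma vfn_conn p X Y : vector_field_near p X -> vector_field_near p Y ->
  vector_field_near p (fun q => D q (X q) Y).
Proof.
move=> vX vY; have [U [oU Up uX uY]] := vfn_common vX vY.
by exists U => //; exact: (conn_smooth affD).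
Qed.

Lemma vfn_bracket p X Y : vector_field_near p X -> vector_field_near p Y ->
  vector_field_near p (bracket X Y).
Proof.
move=> vX vY; have := vfnB (vfn_conn vX vY) (vfn_conn vY vX).
apply: vfn_eq; near=> q; rewrite lc_bracket //; near: q; exact: vfn_near.
Unshelve. all: by end_near. Qed.

Lemma lcZ p u Y (s : R) : tangent p u -> vector_field_near p Y ->
  D p u (fun q => s *: Y q) = s *: D p u Y.
Proof.
move=> tu vY; rewrite (conn_leibniz affD tu (smooth_near_cst p s) vY).
by rewrite (tangent_cst s tu) scale0r add0r.
Qed.

Lemma lcN p u Y : tangent p u -> vector_field_near p Y ->
  D p u (fun q => - Y q) = - D p u Y.
Proof.
move=> tu vY; rewrite -scaleN1r -lcZ //; congr (D p u _).
by apply/funext => q; rewrite scaleN1r.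
Qed.

Lemma lcB p u Y Z : tangent p u -> vector_field_near p Y ->
  vector_field_near p Z -> D p u (fun q => Y q - Z q) = D p u Y - D p u Z.
Proof. by move=> tu vY vZ; rewrite (conn_add affD tu vY (vfnN vZ)) lcN. Qed.

Lemma bracketE p X Y (f : N -> R) : smooth_near p f ->
  bracket X Y p f = X p (fun q => Y q f) - Y p (fun q => X q f).
Proof. by move=> sf; rewrite /bracket asboolT. Qed.

Lemma bracket_out p X Y (f : N -> R) : ~ smooth_near p f -> bracket X Y p f = 0.
Proof. by move=> sf; rewrite /bracket asboolF. Qed.

Lemma bracket_fctE p X Y W (f : N -> R) : vector_field_near p X ->
  vector_field_near p Y -> vector_field_near p W -> smooth_near p f ->
  W p (fun q => bracket X Y q f) =
  W p (fun q => X q (fun r => Y r f)) - W p (fun q => Y q (fun r => X r f)).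
Proof.
move=> vX vY vW sf; have tW := vfn_tangent vW.
rewrite -(tangent_fctB tW); try by do 2 ?apply: vfn_smooth.
apply: (tangent_near_eq tW); near=> q; rewrite bracketE //.
by near: q; exact: smooth_near_near.
Unshelve. all: by end_near. Qed.

(** On smooth functions both sides expand to the same third-order terms; on all other functions
    every bracket is 0 by convention. *)
Lemma jacobi p X Y Z : vector_field_near p X -> vector_field_near p Y ->
  vector_field_near p Z ->
  bracket X (bracket Y Z) p =
  bracket (bracket X Y) Z p + bracket Y (bracket X Z) p.
Proof.
move=> vX vY vZ; apply/funext => f; rewrite fctE.
have [sf|sf] := pselect (smooth_near p f); last first.
  by rewrite !bracket_out // addr0.
rewrite !(bracketE _ _ sf) !bracket_fctE // !bracketE; try exact: vfn_smooth.
by ring.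
Qed.

Lemma lcNl p u Y : tangent p u -> vector_field_near p Y ->
  D p (- u) Y = - D p u Y.
Proof.
move=> tu vY.
have lc0 : D p 0 Y = 0.
  have := conn_linear affD (-1) (tangent0 p) (tangent0 p) vY.
  by rewrite scaler0 addr0 scaleN1r addNr.
have := conn_linear affD (-1) tu (tangent0 p) vY.
by rewrite lc0 !addr0 !scaleN1r.
Qed.

Section AlongSubmanifold.
Context (n : nat) (M : set N) (subM : submanifold n M).

(** Fields tangent to [M] send a transversal coordinate to a function vanishing on [M], and this
    function is annihilated by the other field; so the bracket has no transversal components. *)
Lemma bracket_sub p X Y : M p -> sub_field_near n M p X ->
  sub_field_near n M p Y -> tangent_sub n M p (bracket X Y p).
Proof.
move=> Mp [vX sX] [vY sY]; have [_ /(_ p Mp)[a sa ap]] := subM.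
have [Na sl] := sa; apply/(tangent_subP _ sa ap Mp).
have [y uy] := proj1 (tangentP _ Na ap) (vfn_tangent (vfn_bracket vX vY)).
exists y; split=> // j nj.
rewrite -(dir_deriv_coord y j Na ap) -uy bracketE; last exact: coord_smooth_near.
have zero W : sub_field_near n M p W ->
    \forall q \near p, M q -> W q (fun r => cfun a r 0 j) = 0.
  move=> [vW sW]; near=> q => Mq.
  have aq : cdom a q by near: q; exact: near_cdom.
  have tq : tangent_sub n M q (W q) by move: Mq; near: q.
  apply: (tangent_sub_deriv0 Mq tq).
  by apply: filterS (near_cdom aq) => r ar /(sl r ar); exact.
rewrite (tangent_sub_deriv0 Mp (nbhs_singleton sX Mp) (zero Y _)) //.
by rewrite (tangent_sub_deriv0 Mp (nbhs_singleton sY Mp) (zero X _)) // subrr.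
Unshelve. all: by end_near. Qed.

(** Take [Z] with Z(p) = D_u Y. As g(Y, Z) vanishes on [M] and Y(p) = 0, metric compatibility leaves
    g(D_u Y, D_u Y) = 0. *)
Lemma lc_along0 p u Y : M p -> tangent_sub n M p u -> vector_field_near p Y ->
  (\forall q \near p, M q -> Y q = 0) -> D p u Y = 0.
Proof.
move=> Mp su vY Y0; have tu := tangent_sub_tangent su.
have tD := lc_tangent tu vY; have [Z vZ Zp] := vfn_exists tD.
apply: (metric_eq0 gP tD); rewrite -{2}Zp.
have := lc_metric tu vY vZ; rewrite (nbhs_singleton Y0 Mp).
rewrite (metric0l gP) ?addr0; last exact: lc_tangent.
move=> <-; apply: (tangent_sub_deriv0 Mp su).
near=> q => Mq; rewrite (near Y0 q) // (metric0l gP) //; apply: vfn_tangent.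
by near: q; exact: vfn_near.
Unshelve. all: by end_near. Qed.

Lemma lc_along_eq p u Y Z : M p -> tangent_sub n M p u ->
  vector_field_near p Y -> vector_field_near p Z ->
  (\forall q \near p, M q -> Y q = Z q) -> D p u Y = D p u Z.
Proof.
move=> Mp su vY vZ YZ; apply/eqP; rewrite -subr_eq0 -lcB //; last first.
  exact: tangent_sub_tangent su.
apply/eqP/(lc_along0 Mp su); first exact: vfnB.
by apply: filterS YZ => q YZq Mq; rewrite YZq // subrr.
Qed.

End AlongSubmanifold.
End LeviCivita.

(** * Symmetry of h' and phi h' on a contact metric manifold *)

Section Contact.
Context {R : realType} {d : nat} (N : manifold R d).
Local Notation V := (functional N R).
Context (g : N -> V -> V -> R) (phi : N -> V -> V) (xi : N -> V)
  (eta : N -> V -> R) (h' : N -> V -> V) (D : N -> V -> (N -> V) -> V).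
Context (cm : contact_metric g phi xi eta)
  (lieP : forall p X, vector_field_near p X ->
     2%:R *: h' p (X p) = lie_phi phi xi p X)
  (lc : levi_civita g D).
Implicit Types (p q : N) (u v w : V) (X Y Z : N -> V).

Let ac : almost_contact_metric g phi xi eta := proj1 cm.
Let gP : riemannian_metric g := ac_metric ac.
Let affD : affine_connection D. Proof. by case: lc. Qed.

Lemma phi_tangent p u : tangent p u -> tangent p (phi p u).
Proof. exact: (ac_phi_tangent ac). Qed.

Lemma vfn_xi p : vector_field_near p xi.
Proof.
by exists setT; [split=> //; exact: openT|exact: ac_xi ac].
Qed.

Lemma xi_tangent p : tangent p (xi p).
Proof. exact: vfn_tangent (vfn_xi p). Qed.

Local Hint Resolve phi_tangent xi_tangent vfn_xi : tg.

Lemma vfn_phi p X : vector_field_near p X ->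
  vector_field_near p (fun q => phi q (X q)).
Proof. by move=> [U oU vX]; exists U => //; exact: (ac_phi_smooth ac). Qed.

Lemma etaE p u : tangent p u -> eta p u = g p u (xi p).
Proof. by move=> tu; rewrite (ac_g_xi ac). Qed.

Lemma metric_xi_xi p : g p (xi p) (xi p) = 1.
Proof. by rewrite -etaE ?(ac_eta_xi ac) //; exact: xi_tangent. Qed.

Lemma metric_phi_xi p u : tangent p u -> g p (phi p u) (xi p) = 0.
Proof. by move=> tu; rewrite -etaE ?(ac_eta_phi ac) //; exact: phi_tangent. Qed.

Lemma metric_phi p u v : tangent p u -> tangent p v ->
  g p (phi p u) v = - g p u (phi p v).
Proof. by move=> tu tv; rewrite (ac_g_phi ac) // opprK. Qed.

Lemma phi_phi p u : tangent p u ->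
  phi p (phi p u) = - u + g p u (xi p) *: xi p.
Proof. by move=> tu; rewrite (ac_phi2 ac) // etaE. Qed.

Lemma phi0 p : phi p 0 = 0.
Proof.
have := ac_phi_linear ac (-1) (tangent0 p) (tangent0 p).
by rewrite scaler0 addr0 scaleN1r addNr.
Qed.

Lemma phiZ p (s : R) u : tangent p u -> phi p (s *: u) = s *: phi p u.
Proof.
move=> tu; have := ac_phi_linear ac s tu (tangent0 p).
by rewrite phi0 !addr0.
Qed.

Lemma phiB p u v : tangent p u -> tangent p v -> phi p (u - v) = phi p u - phi p v.
Proof.
move=> tu tv; have := ac_phi_linear ac (-1) tv tu.
by rewrite !scaleN1r addrC [RHS]addrC.
Qed.

(** The function eta(X), written with the metric because its smoothness then comes from that of
    [g]. *)
Let contact_fct X := fun q => g q (X q) (xi q).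

Let contact_fct_smooth p X : vector_field_near p X ->
  smooth_near p (contact_fct X).
Proof. by move=> vX; apply: (metric_smooth gP) => //; exact: vfn_xi. Qed.

Lemma contact_form_diff p X Y : vector_field_near p X -> vector_field_near p Y ->
  2%:R * g p (X p) (phi p (Y p)) =
  X p (contact_fct Y) - Y p (contact_fct X) - contact_fct (bracket X Y) p.
Proof.
move=> vX vY; have [_ -> //] := cm.
rewrite mulrA divff ?mul1r ?pnatr_eq0 //.
have nE W : vector_field_near p W ->
    \forall q \near p, eta q (W q) = contact_fct W q.
  by move=> vW; apply: filterS (vfn_near vW) => q /vfn_tangent; exact: etaE.
congr (_ - _ - _).
- exact: (tangent_near_eq (vfn_tangent vX) (nE Y vY)).
- exact: (tangent_near_eq (vfn_tangent vY) (nE X vX)).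
- by rewrite etaE //; apply: vfn_tangent; exact: (vfn_bracket lc).
Qed.

(** This is L_xi eta = 0: in 2 d eta(xi, Y) = 2 g(xi, phi Y) = 0, the term Y(eta(xi)) is the
    derivative of the constant 1. *)
Lemma xi_contact_fct p Y : vector_field_near p Y ->
  xi p (contact_fct Y) = contact_fct (bracket xi Y) p.
Proof.
move=> vY; have := contact_form_diff (vfn_xi p) vY.
rewrite (metricC gP) ?metric_phi_xi; try solve [auto using vfn_tangent with tg].
rewrite mulr0 (_ : contact_fct xi = cst 1); last first.
  by apply/funext => q; exact: metric_xi_xi.
rewrite (tangent_cst 1 (vfn_tangent vY)) subr0 => /esym/eqP.
by rewrite subr_eq0 => /eqP.
Qed.

(** Both sides equal xi(g(X, phi Y)): the left by metric compatibility, the right because L_xi d eta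
    = 0, which follows from L_xi eta = 0 and the Jacobi identity. *)
Lemma lie_contact p X Y : vector_field_near p X -> vector_field_near p Y ->
  g p (D p (xi p) X) (phi p (Y p)) + g p (X p) (D p (xi p) (fun q => phi q (Y q)))
  = g p (bracket xi X p) (phi p (Y p)) + g p (X p) (phi p (bracket xi Y p)).
Proof.
move=> vX vY; have vxi := vfn_xi p; have txi := xi_tangent p.
have vXY := vfn_bracket lc vX vY.
have [vxX vxY] := (vfn_bracket lc vxi vX, vfn_bracket lc vxi vY).
rewrite -(lc_metric lc txi vX (vfn_phi vY)).
have n2 : 2%:R != 0 :> R by rewrite pnatr_eq0.
apply: (mulfI n2); rewrite mulrDr.
rewrite (contact_form_diff vxX vY) (contact_form_diff vX vxY).
have sLX := contact_fct_smooth vX; have sLY := contact_fct_smooth vY.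
have dxi W W' : vector_field_near p W -> vector_field_near p W' ->
    W p (contact_fct (bracket xi W')) = W p (fun q => xi q (contact_fct W')).
  move=> vW vW'; apply: (tangent_near_eq (vfn_tangent vW)).
  by apply: filterS (vfn_near vW') => q vq; rewrite -xi_contact_fct.
rewrite (dxi Y X) // (dxi X Y) // !(bracketE _ _ sLX) !(bracketE _ _ sLY).
have -> : 2%:R * xi p (fun q => g q (X q) (phi q (Y q))) =
    xi p (fun q => X q (contact_fct Y) - Y q (contact_fct X)
                   - contact_fct (bracket X Y) q).
  rewrite -(tangent_fctZ _ txi); last exact: (metric_smooth gP vX (vfn_phi vY)).
  apply: (tangent_near_eq txi); near=> q; apply: contact_form_diff.
    by near: q; exact: vfn_near.
  by near: q; exact: vfn_near.
have sXY : smooth_near p (fun q => X q (contact_fct Y)) by exact: vfn_smooth.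
have sYX : smooth_near p (fun q => Y q (contact_fct X)) by exact: vfn_smooth.
have sbr := contact_fct_smooth vXY.
rewrite (tangent_fctB txi (smooth_nearB sXY sYX) sbr) (tangent_fctB txi sXY sYX).
rewrite xi_contact_fct // /contact_fct (jacobi vxi vX vY) (metricDl gP) //.
- by ring.
- exact: (vfn_tangent (vfn_bracket lc vxX vY)).
- exact: (vfn_tangent (vfn_bracket lc vX vxY)).
Unshelve. all: by end_near. Qed.

Definition lie_metric p u v : R := g p (D p u xi) v + g p u (D p v xi).

Lemma xi_lc_tangent p u : tangent p u -> tangent p (D p u xi).
Proof. by move=> tu; apply: (lc_tangent lc tu); exact: vfn_xi. Qed.

Local Hint Resolve xi_lc_tangent : tg.

Lemma metric_lc_xi p u : tangent p u -> g p (D p u xi) (xi p) = 0.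
Proof.
move=> tu; have := lc_metric lc tu (vfn_xi p) (vfn_xi p).
rewrite (_ : (fun q => _) = cst 1); last first.
  by apply/funext => q; exact: metric_xi_xi.
rewrite (tangent_cst 1 tu) (metricC gP (xi_tangent p)) -?mulr2n.
  by move=> /esym/eqP; rewrite mulrn_eq0 => /eqP.
exact: xi_lc_tangent.
Qed.

(** In xi(eta(Y)) = eta([xi, Y]) the terms g(D_xi Y, xi) cancel and g(D_Y xi, xi) = 0, which leaves
    g(Y, D_xi xi) = 0; [Y] is then chosen with value D_xi xi at p. *)
Lemma lc_xi_xi p : D p (xi p) xi = 0.
Proof.
have tD : tangent p (D p (xi p) xi) by auto with tg.
have [Y vY Yp] := vfn_exists tD; apply: (metric_eq0 gP tD); rewrite -{2}Yp.
have tY := vfn_tangent vY; have txi := xi_tangent p.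
have := xi_contact_fct vY; rewrite {2}/contact_fct (lc_metric lc txi vY (vfn_xi p)).
rewrite (lc_bracket lc (vfn_xi p) vY) (metricBl gP) ?metric_lc_xi //; last first.
- exact: xi_lc_tangent.
- exact: (lc_tangent lc).
by rewrite subr0 (metricC gP tY tD) => /eqP; rewrite addrC -subr_eq0 addrK => /eqP.
Qed.

Lemma lie_metricC p u v : tangent p u -> tangent p v ->
  lie_metric p u v = lie_metric p v u.
Proof.
move=> tu tv; rewrite /lie_metric addrC.
by congr (_ + _); apply: (metricC gP); auto with tg.
Qed.

Lemma lie_metricPr p (s : R) u v w : tangent p u -> tangent p v -> tangent p w ->
  lie_metric p w (s *: u + v) = s * lie_metric p w u + lie_metric p w v.
Proof.
move=> tu tv tw; rewrite /lie_metric (conn_linear affD _ tu tv (vfn_xi p)).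
rewrite !(metricDr gP) ?(metricZr gP); try solve [auto with tg].
by ring.
Qed.

Lemma lie_metric_xi p u : tangent p u -> lie_metric p u (xi p) = 0.
Proof.
move=> tu; rewrite /lie_metric metric_lc_xi // lc_xi_xi (metric0r gP) //.
by rewrite addr0.
Qed.

Lemma h_tangent p u : tangent p u -> tangent p (h' p u).
Proof.
move=> /vfn_exists[X vX <-].
have -> : h' p (X p) = 2%:R^-1 *: (2%:R *: h' p (X p)).
  by rewrite scalerA mulVf ?scale1r // pnatr_eq0.
rewrite lieP // /lie_phi; apply/tangentZ/tangentB.
  exact: (vfn_tangent (vfn_bracket lc (vfn_xi p) (vfn_phi vX))).
by apply/phi_tangent; exact: (vfn_tangent (vfn_bracket lc (vfn_xi p) vX)).
Qed.

Local Hint Resolve h_tangent : tg.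

(** By torsion-freeness 2 h'Y = D_xi(phi Y) - D_{phi Y} xi - phi [xi, Y]. Paired with X, the first
    and last terms give g([xi, X] - D_xi X, phi Y) = - g(D_X xi, phi Y) by [lie_contact]. *)
Lemma metric_h_lie p u v : tangent p u -> tangent p v ->
  2%:R * g p u (h' p v) = - lie_metric p u (phi p v).
Proof.
move=> /vfn_exists[X vX <-] /vfn_exists[Y vY <-].
have [tX tY] := (vfn_tangent vX, vfn_tangent vY).
have vxi := vfn_xi p; have txi := xi_tangent p.
have [vxX vxY] := (vfn_bracket lc vxi vX, vfn_bracket lc vxi vY).
have [txX txY] := (vfn_tangent vxX, vfn_tangent vxY).
have vpY := vfn_phi vY; have tDX := lc_tangent lc txi vX.
have tDpY := lc_tangent lc txi vpY.
rewrite -(metricZr gP) ?lieP //; last exact: h_tangent.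
have := lie_contact vX vY; rewrite /lie_phi (lc_bracket lc vxi vpY).
rewrite !(metricBr gP); try solve [auto with tg].
rewrite /lie_metric {1}(lc_bracket lc vxi vX) (metricBl gP); try solve [auto with tg].
move=> H; apply/eqP; rewrite -subr_eq0; apply/eqP.
by lra.
Qed.

Lemma metric_nondeg p u v : tangent p u -> tangent p v ->
  (forall w, tangent p w -> g p w u = g p w v) -> u = v.
Proof.
move=> tu tv uv; apply/eqP; rewrite -subr_eq0; apply/eqP.
apply: (metric_eq0 gP (p := p)); first exact: tangentB.
by rewrite (metricBr gP) ?uv ?subrr //; exact: tangentB.
Qed.

(** The defining relation of [h'] speaks of fields, not of linearity at a point; [metric_h_lie]
    expresses g(w, h'v) by a form linear in v, and the metric is nondegenerate. *)
Lemma h_lin p (s : R) u v : tangent p u -> tangent p v ->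
  h' p (s *: u + v) = s *: h' p u + h' p v.
Proof.
move=> tu tv; apply: (@metric_nondeg p); try solve [auto with tg].
move=> w tw.
have n2 : 2%:R != 0 :> R by rewrite pnatr_eq0.
apply: (mulfI n2); rewrite metric_h_lie; try solve [auto with tg].
rewrite (metricDr gP) ?(metricZr gP); try solve [auto with tg].
rewrite (ac_phi_linear ac) // lie_metricPr; try solve [auto with tg].
have [Hu Hv] := (metric_h_lie tw tu, metric_h_lie tw tv).
by rewrite opprD -mulrN -Hu -Hv; ring.
Qed.

(** Twice each side contains - phi [xi, phi X], so the claim is [xi, phi^2 X] = phi^2 [xi, X]. With
    phi^2 X = - X + eta(X) xi this is L_xi eta = 0 again. *)
Lemma h_phi p u : tangent p u -> h' p (phi p u) = - phi p (h' p u).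
Proof.
move=> /vfn_exists[X vX <-] {u}; have n2 : 2%:R != 0 :> R by rewrite pnatr_eq0.
have vxi := vfn_xi p; have txi := xi_tangent p; have tX := vfn_tangent vX.
have vpX := vfn_phi vX; have tpX := vfn_tangent vpX.
have vxX := vfn_bracket lc vxi vX; have txX := vfn_tangent vxX.
have vxpX := vfn_bracket lc vxi vpX; have txpX := vfn_tangent vxpX.
have tpxX := phi_tangent txX; have thX := h_tangent tX.
have lin2 w1 w2 : 2%:R *: w1 = 2%:R *: w2 -> w1 = w2 :> V.
  by move=> /(congr1 (fun w => 2%:R^-1 *: w)); rewrite !scalerA mulVf ?scale1r.
apply: lin2; rewrite scalerN -(phiZ _ thX) (lieP vX) (lieP vpX) /lie_phi.
rewrite phiB // opprB; congr (_ - _); rewrite phi_phi //.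
rewrite (lc_bracket lc vxi (vfn_phi vpX)).
have sLX := contact_fct_smooth vX.
(* [C] is phi^2 X in a form to which the Leibniz rule applies; it agrees with phi^2 X only near p,
   where [X] is known to be tangent. *)
pose C := fun q => contact_fct X q *: xi q - X q.
have vC : vector_field_near p C by apply: vfnB => //; exact: vfnZ.
have phiC : \forall q \near p, phi q (phi q (X q)) = C q.
  by apply: filterS (vfn_near vX) => q /vfn_tangent tq; rewrite phi_phi // addrC.
rewrite (conn_local affD txi (vfn_phi vpX) phiC) (nbhs_singleton phiC) /C.
rewrite (lcB lc txi (vfnZ sLX vxi) vX) (conn_leibniz affD txi sLX vxi).
rewrite (conn_linear affD _ txi (tangentN tX) vxi) (lcNl lc) // lc_xi_xi.
rewrite !scaler0 addr0 add0r xi_contact_fct // opprK -addrA addrC.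
rewrite /contact_fct; congr (_ + _).
by rewrite (lc_bracket lc vxi vX) opprB addrC.
Qed.

(** Replace v by phi v in [metric_h_lie]: phi^2 v differs from - v by a multiple of xi, which the
    Lie derivative of the metric ignores. *)
Lemma metric_phi_h_lie p u v : tangent p u -> tangent p v ->
  2%:R * g p u (phi p (h' p v)) = - lie_metric p u v.
Proof.
move=> tu tv; have := metric_h_lie tu (phi_tangent tv).
rewrite h_phi // (metricNr gP) ?phi_phi //; try solve [auto with tg].
have -> : - v + g p v (xi p) *: xi p = g p v (xi p) *: xi p + (-1) *: v.
  by rewrite addrC scaleN1r.
rewrite lie_metricPr ?lie_metric_xi //; try solve [auto with tg].
have -> : lie_metric p u (-1 *: v) = - lie_metric p u v.
  have := lie_metricPr (-1) tv (tangent0 p) tu; rewrite addr0 => ->.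
  have -> : lie_metric p u 0 = 0.
    have := lie_metricPr (-1) (tangent0 p) (tangent0 p) tu.
    by rewrite scaler0 addr0 mulN1r addNr.
  by rewrite addr0 mulN1r.
by move=> H; lra.
Qed.

Lemma phi_h_sym p u v : tangent p u -> tangent p v ->
  g p u (phi p (h' p v)) = g p (phi p (h' p u)) v.
Proof.
move=> tu tv; have n2 : 2%:R != 0 :> R by rewrite pnatr_eq0.
apply: (mulfI n2); rewrite (metricC gP _ tv); last by auto with tg.
by rewrite !metric_phi_h_lie // lie_metricC.
Qed.

(** Since h'v is orthogonal to xi, g(u, h'v) = g(phi u, phi h'v), and [metric_phi_h_lie] turns this
    into a value of the symmetric form [lie_metric]. *)
Lemma h_sym p u v : tangent p u -> tangent p v ->
  g p u (h' p v) = g p (h' p u) v.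
Proof.
move=> tu tv; have n2 : 2%:R != 0 :> R by rewrite pnatr_eq0.
have hxi w : tangent p w -> g p (h' p w) (xi p) = 0.
  move=> tw; have thw := h_tangent tw; have tpw := phi_tangent tw.
  rewrite (metricC gP thw (xi_tangent p)); apply: (mulfI n2).
  rewrite (metric_h_lie (xi_tangent p) tw) (lie_metricC (xi_tangent p) tpw).
  by rewrite (lie_metric_xi tpw) oppr0 mulr0.
have E : g p (phi p u) (phi p (h' p v)) = g p u (h' p v).
  rewrite metric_phi ?phi_phi; try solve [auto with tg].
  rewrite hxi // scale0r addr0 (metricNr gP) ?opprK //; auto with tg.
apply: (mulfI n2); rewrite -E metric_phi_h_lie; try solve [auto with tg].
rewrite (metricC gP (h_tangent tu) tv) metric_h_lie // lie_metricC //.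
by auto with tg.
Qed.

End Contact.

(** * The second fundamental form and the Gauss equation of the induced connection *)

Section Gauss.
Context {R : realType} {d : nat} (N : manifold R d).
Local Notation V := (functional N R).
Context (g : N -> V -> V -> R) (gP : riemannian_metric g).
Context (D : N -> V -> (N -> V) -> V) (lc : levi_civita g D).
Context (P : N -> V) (vfP : vector_field setT P) (l1 l2 : R).
Context (n : nat) (M : set N) (subM : submanifold n M).
Implicit Types (p q : N) (u v w z : V) (X Y Z W : N -> V).

Let affD : affine_connection D. Proof. by case: lc. Qed.
Local Notation nbar := (conn_bar g D P l1 l2).
Local Notation ind := (induced_conn n M g nbar).
Local Notation tan := (tan_part n M g).
Local Notation tsub := (tangent_sub n M).
Local Notation h := (second_form n M g nbar).

Let vfnP p : vector_field_near p P.
Proof. by exists setT => //; split=> //; exact: openT. Qed.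

Let tP p : tangent p (P p). Proof. exact: vfn_tangent (vfnP p). Qed.

Lemma vfn_conn_bar p X Y : vector_field_near p X -> vector_field_near p Y ->
  vector_field_near p (fun q => nbar q (X q) Y).
Proof.
move=> vX vY; apply: vfnB; first apply: vfnD.
- exact: (vfn_conn lc).
- apply: vfnZ => //; apply: smooth_nearM; first exact: smooth_near_cst.
  exact: (metric_smooth gP).
- apply: vfnZ => //; apply: smooth_nearM; first exact: smooth_near_cst.
  exact: (metric_smooth gP).
Qed.

Lemma conn_bar_tangent p u Y : tangent p u -> vector_field_near p Y ->
  tangent p (nbar p u Y).
Proof.
move=> tu vY; apply: tangentB; last exact: tangentZ.
by apply: tangentD; [exact: (lc_tangent lc)|exact: tangentZ].
Qed.

Lemma conn_bar_metric p u Y w : tangent p u -> vector_field_near p Y ->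
  tangent p w ->
  g p (nbar p u Y) w = g p (D p u Y) w + l1 * one_form g P p (Y p) * g p u w
    - l2 * g p u (Y p) * one_form g P p w.
Proof.
move=> tu vY tw; have tDY := lc_tangent lc tu vY; have tPp := tP p.
rewrite /conn_bar (metricBl gP); try solve [auto 6 with tg].
rewrite (metricDl gP) ?(metricZl gP); solve [auto 6 with tg].
Qed.

Lemma conn_bar_along p u Y Z : M p -> tsub p u -> vector_field_near p Y ->
  vector_field_near p Z -> (\forall q \near p, M q -> Y q = Z q) ->
  nbar p u Y = nbar p u Z.
Proof.
move=> Mp su vY vZ YZ; rewrite /conn_bar (nbhs_singleton YZ Mp).
by rewrite (lc_along_eq gP lc Mp su vY vZ YZ).
Qed.

(** [along_extend] is an arbitrary choice; this allows any extension of the field to be used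
    instead. *)
Lemma induced_connE p u Y Y' : M p -> tsub p u -> vector_field_near p Y' ->
  (\forall q \near p, M q -> Y' q = Y q) -> ind p u Y = tan p (nbar p u Y').
Proof.
move=> Mp su vY' Y'Y; have [vE E] := along_extendP vY' Y'Y.
rewrite /induced_conn; congr tan_part; apply: conn_bar_along => //.
near=> q => Mq; have -> : Y' q = Y q by move: Mq; near: q.
by move: Mq; near: q.
Unshelve. all: by end_near. Qed.

Definition normal_part p v := v - tan p v.

Lemma normal_tangent p v : M p -> tangent p v -> tangent p (normal_part p v).
Proof. by move=> Mp tv; apply: tangentB => //; exact: (tan_part_tangent subM gP). Qed.

Lemma normal_metric p v w : M p -> tangent p v -> tsub p w ->
  g p (normal_part p v) w = 0.
Proof. by move=> Mp tv; have [_] := tan_partP subM gP Mp tv; apply. Qed.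

Lemma normal_lin p (s : R) u v : M p -> tangent p u -> tangent p v ->
  normal_part p (s *: u + v) = s *: normal_part p u + normal_part p v.
Proof.
move=> Mp tu tv; rewrite /normal_part (tan_part_lin subM gP) // scalerBr.
by rewrite opprD addrACA.
Qed.

Lemma normalB p u v : M p -> tangent p u -> tangent p v ->
  normal_part p (u - v) = normal_part p u - normal_part p v.
Proof.
move=> Mp tu tv; have := normal_lin (-1) Mp tv tu.
by rewrite !scaleN1r addrC [RHS]addrC.
Qed.

Lemma normal_sub p u : M p -> tsub p u -> normal_part p u = 0.
Proof. by move=> Mp su; rewrite /normal_part (tan_part_id subM gP) // subrr. Qed.

Lemma metric_normal p u v : M p -> tangent p u -> tangent p v ->
  g p (normal_part p u) v = g p (normal_part p u) (normal_part p v).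
Proof.
move=> Mp tu tv; have tn := normal_tangent Mp tu.
rewrite {3}/normal_part (metricBr gP) //; last exact: (tan_part_tangent subM gP).
by rewrite (normal_metric Mp tu (tan_part_sub subM gP Mp tv)) subr0.
Qed.

(** The difference is the normal part of the bracket [X, Y], which is tangent to [M]. *)
Lemma normal_lcC p X Y : M p -> sub_field_near n M p X -> sub_field_near n M p Y ->
  normal_part p (D p (X p) Y) = normal_part p (D p (Y p) X).
Proof.
move=> Mp sX sY; have [[vX _] [vY _]] := (sX, sY).
apply/eqP; rewrite -subr_eq0 -normalB //; first last.
- exact: (lc_tangent lc (vfn_tangent vY)).
- exact: (lc_tangent lc (vfn_tangent vX)).
rewrite -(lc_bracket lc vX vY) normal_sub //.
exact: (bracket_sub lc subM).
Qed.

(** Exchanging the two arguments moves the field into the slot where only its value at p counts. *)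
Lemma normal_lc_field p u Y Z : M p -> tsub p u -> sub_field_near n M p Y ->
  sub_field_near n M p Z -> Y p = Z p ->
  normal_part p (D p u Y) = normal_part p (D p u Z).
Proof.
move=> Mp su sY sZ YZ; have [sX Xp] := sub_extendP su.
by rewrite -Xp normal_lcC // YZ -normal_lcC.
Qed.

(** The [l1] term of nabla-bar is a multiple of [u], hence tangent to [M]; only the [l2] term
    survives. *)
Lemma normal_conn_bar p u Y : M p -> tsub p u -> vector_field_near p Y ->
  normal_part p (nbar p u Y) =
  normal_part p (D p u Y) - (l2 * g p u (Y p)) *: normal_part p (P p).
Proof.
move=> Mp su vY; have tu := tangent_sub_tangent su.
have tD := lc_tangent lc tu vY.
rewrite /conn_bar normalB //; last exact: tangentZ; last first.
  by apply: tangentD => //; exact: tangentZ.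
rewrite addrC [D p u Y + _]addrC normal_lin // (normal_sub Mp su) scaler0 add0r.
rewrite -[X in normal_part p X]addr0 normal_lin //; last exact: tangent0.
rewrite (normal_sub Mp (tangent_sub0 subM Mp)) addr0; exact: addrC.
Qed.

Lemma second_formE p u Y : M p -> tsub p u -> sub_field_near n M p Y ->
  h p u (Y p) = normal_part p (nbar p u Y).
Proof.
move=> Mp su sY; have [[vY _] sYp] := (sY, sub_field_tangent Mp sY).
have [sX Xp] := sub_extendP sYp; have [vX _] := sX.
rewrite /second_form -/(normal_part p _) !normal_conn_bar // Xp.
by rewrite (normal_lc_field Mp su sX sY).
Qed.

Lemma second_form_tangent p u w : M p -> tsub p u -> tsub p w ->
  tangent p (h p u w).
Proof.
move=> Mp su sw; have [sX Xp] := sub_extendP sw; have [vX _] := sX.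
rewrite -Xp second_formE //; apply: normal_tangent => //.
exact: (conn_bar_tangent (tangent_sub_tangent su)).
Qed.

Lemma second_formC p u w : M p -> tsub p u -> tsub p w -> h p u w = h p w u.
Proof.
move=> Mp su sw; have [sX Xp] := sub_extendP sw; have [vX _] := sX.
have [sY Yp] := sub_extendP su; have [vY _] := sY.
rewrite -{1}Xp -{2}Yp !second_formE // !normal_conn_bar // Xp Yp.
rewrite (metricC gP (tangent_sub_tangent su) (tangent_sub_tangent sw)).
by have := normal_lcC Mp sY sX; rewrite Xp Yp => ->.
Qed.

Lemma second_form_linl p (s : R) u v w : M p -> tsub p u -> tsub p v -> tsub p w ->
  h p (s *: u + v) w = s *: h p u w + h p v w.
Proof.
move=> Mp su sv sw; have [sX Xp] := sub_extendP sw; have [vX _] := sX.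
have [tu tv] := (tangent_sub_tangent su, tangent_sub_tangent sv).
have tw := tangent_sub_tangent sw.
have suv := tangent_sub_lin subM s Mp su sv.
rewrite -Xp !second_formE // !normal_conn_bar // Xp.
rewrite (conn_linear affD _ tu tv vX) normal_lin //; try exact: (lc_tangent lc).
rewrite (metricPl gP) // mulrDr scalerDl [in RHS]scalerBr [in RHS]scalerA opprD.
by rewrite addrACA [s * (l2 * _)]mulrCA.
Qed.

Lemma second_form_linr p (s : R) u v w : M p -> tsub p u -> tsub p v -> tsub p w ->
  h p w (s *: u + v) = s *: h p w u + h p w v.
Proof.
move=> Mp su sv sw; have suv := tangent_sub_lin subM s Mp su sv.
rewrite second_formC // second_form_linl //.
by rewrite (second_formC Mp sw su) (second_formC Mp sw sv).
Qed.

(** (D_u pi)(w), by metric compatibility. *)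
Let c p u w := g p (D p u P) w.

Lemma one_form_deriv p X Z : vector_field_near p X -> vector_field_near p Z ->
  X p (fun q => one_form g P q (Z q)) =
  c p (X p) (Z p) + one_form g P p (D p (X p) Z).
Proof. by move=> vX vZ; apply: (lc_metric lc (vfn_tangent vX) (vfnP p) vZ). Qed.

Lemma lc_conn_bar p X Y Z w : vector_field_near p X -> vector_field_near p Y ->
  vector_field_near p Z -> tangent p w ->
  g p (D p (X p) (fun q => nbar q (Y q) Z)) w =
  g p (D p (X p) (fun q => D q (Y q) Z)) w
  + l1 * (X p (fun q => one_form g P q (Z q)) * g p (Y p) w
          + one_form g P p (Z p) * g p (D p (X p) Y) w)
  - l2 * (X p (fun q => g q (Y q) (Z q)) * g p (P p) w
          + g p (Y p) (Z p) * c p (X p) w).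
Proof.
move=> vX vY vZ tw; have tX := vfn_tangent vX; have tY := vfn_tangent vY.
have tPp := tP p; have vP := vfnP p.
have tDY := lc_tangent lc tX vY; have tDP := lc_tangent lc tX vP.
have vDYZ := vfn_conn lc vY vZ; have tDDZ := lc_tangent lc tX vDYZ.
have spi : smooth_near p (fun q => one_form g P q (Z q)).
  exact: (metric_smooth gP vP vZ).
have sg := metric_smooth gP vY vZ.
have slpi := smooth_nearM (smooth_near_cst p l1) spi.
have slg := smooth_nearM (smooth_near_cst p l2) sg.
have vB := vfnZ slpi vY; have vC := vfnZ slg vP.
rewrite /conn_bar (lcB lc tX (vfnD vDYZ vB) vC) (conn_add affD tX vDYZ vB).
rewrite (conn_leibniz affD tX slpi vY) (conn_leibniz affD tX slg vP).
rewrite (tangent_fctZ _ tX spi) (tangent_fctZ _ tX sg) /c.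
rewrite (metricBl gP); try solve [auto 6 with tg].
rewrite !(metricDl gP); try solve [auto 6 with tg].
rewrite !(metricZl gP); try solve [auto 6 with tg].
by ring.
Qed.

(** The induced derivative is meaningful only on [M]. To be differentiated once more it needs a
    smooth ambient field agreeing with it there; the last clause keeps the fact that the remainder
    is normal along [M]. *)
Lemma induced_field p Y Z : M p -> sub_field_near n M p Y ->
  vector_field_near p Z ->
  exists F', [/\ vector_field_near p F',
    \forall q \near p, M q -> F' q = ind q (Y q) Z &
    \forall q \near p, M q ->
      forall w, tsub q w -> g q (nbar q (Y q) Z - F' q) w = 0].
Proof.
move=> Mp [vY nY] vZ; have vF := vfn_conn_bar vY vZ.
have [F' vF' nF'] := tan_field subM gP Mp vF.
exists F'; split=> //; last by apply: filterS nF' => q nq /nq[].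
near=> q => Mq.
have vZq : vector_field_near q Z by near: q; exact: vfn_near.
have vFq : vector_field_near q (fun q => nbar q (Y q) Z).
  by near: q; exact: vfn_near.
have tsYq : tsub q (Y q) by move: Mq; near: q.
rewrite (induced_connE Mq tsYq vZq); last by apply: nearW.
have [tF' oF'] : tsub q (F' q) /\
    forall w, tsub q w -> g q (nbar q (Y q) Z - F' q) w = 0.
  by move: Mq; near: q.
apply/esym/(tan_part_uniq subM gP) => // [|w tw]; first exact: (vfn_tangent vFq).
apply/eqP; rewrite eq_sym -subr_eq0 -(metricBl gP) ?oF' //.
- exact: (vfn_tangent vFq).
- exact: tangent_sub_tangent tF'.
- exact: tangent_sub_tangent tw.
Unshelve. all: by end_near. Qed.

Lemma induced_induced p X Y Z W : M p -> sub_field_near n M p X ->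
  sub_field_near n M p Y -> sub_field_near n M p Z -> sub_field_near n M p W ->
  g p (ind p (X p) (fun q => ind q (Y q) Z)) (W p) =
  g p (D p (X p) (fun q => nbar q (Y q) Z)) (W p)
  + g p (h p (Y p) (Z p)) (D p (X p) W)
  + l1 * one_form g P p (tan p (nbar p (Y p) Z)) * g p (X p) (W p)
  - l2 * g p (X p) (tan p (nbar p (Y p) Z)) * one_form g P p (W p).
Proof.
move=> Mp sX sY sZ sW.
have [vX _] := sX; have [vY nY] := sY; have [vZ _] := sZ; have [vW nW] := sW.
have tX := vfn_tangent vX; have tW := vfn_tangent vW; have tPp := tP p.
have tsX := sub_field_tangent Mp sX; have tsY := sub_field_tangent Mp sY.
have tsW := sub_field_tangent Mp sW.
pose F q := nbar q (Y q) Z.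
have vF : vector_field_near p F by exact: vfn_conn_bar.
have [F' [vF' F'E nF']] := induced_field Mp sY vZ.
have tF := vfn_tangent vF; have tF' := vfn_tangent vF'.
have F'p : F' p = tan p (F p).
  rewrite (nbhs_singleton F'E Mp) (induced_connE Mp tsY vZ) //.
  exact: nearW.
rewrite (induced_connE Mp tsX vF' F'E) (tan_part_metric subM gP) //; last first.
  exact: conn_bar_tangent.
have vN := vfnB vF vF'; have tDF' := lc_tangent lc tX vF'.
have tDF := lc_tangent lc tX vF; have tDW := lc_tangent lc tX vW.
(* F - F' stays normal along M, so moving the derivative onto W costs the
   second fundamental form. *)
have DF' : g p (D p (X p) F') (W p) = g p (D p (X p) F) (W p)
    + g p (F p - F' p) (D p (X p) W).
  have := lc_metric lc tX vN vW; rewrite (lcB lc tX vF vF') (metricBl gP) //.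
  rewrite (tangent_sub_deriv0 Mp tsX); first by move=> /esym H; lra.
  near=> q => Mq; have tsWq : tsub q (W q) by move: Mq; near: q.
  by apply: (near nF' q).
rewrite (second_formE Mp tsY sZ) /normal_part -/(F p) -F'p.
by rewrite conn_bar_metric // DF'.
Unshelve. all: by end_near. Qed.

(** Only the normal part of D_u W pairs with h(v, w), and it is h(u, W) plus l2 g(u, W) times the
    normal part of P. *)
Lemma second_form_lc p u v w W : M p -> tsub p u -> tsub p v -> tsub p w ->
  sub_field_near n M p W ->
  g p (h p v w) (D p u W) =
  g p (h p v w) (h p u (W p)) + l2 * g p u (W p) * one_form g P p (h p v w).
Proof.
move=> Mp su sv sw sW; have [vW _] := sW; have tW := vfn_tangent vW.
have tu := tangent_sub_tangent su; have tPp := tP p.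
have tDW := lc_tangent lc tu vW.
have [sX Xp] := sub_extendP sw; have [vX _] := sX.
have th := second_form_tangent Mp sv sw.
have hE : h p v w = normal_part p (nbar p v (sub_extend n M p w)).
  by rewrite -{1}Xp second_formE.
have tn := conn_bar_tangent (tangent_sub_tangent sv) vX.
have hn z : tangent p z -> g p (h p v w) (normal_part p z) = g p (h p v w) z.
  by move=> tz; rewrite hE -metric_normal.
rewrite (second_formE Mp su sW) (normal_conn_bar Mp su vW).
have tnD := normal_tangent Mp tDW; have tnP := normal_tangent Mp tPp.
rewrite (metricBr gP); try solve [auto with tg].
rewrite (metricZr gP); try solve [auto with tg].
rewrite (hn _ tDW) (hn _ tPp) /one_form (metricC gP tPp th); ring.
Qed.

(** The factor [l2 - l1] has two origins: [l2] comes from rewriting g(h, D W) through the second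
    fundamental form, and [- l1] from pi of a tangential part, which is pi of the whole derivative
    minus pi(h). *)
Lemma gauss_equation p u v w z : M p -> tsub p u -> tsub p v -> tsub p w ->
  tsub p z ->
  sub_curvature n M g nbar p u v w z =
  g p (curvature D p (sub_extend n M p u) (sub_extend n M p v)
         (sub_extend n M p w)) z
  + g p (h p v w) (h p u z) - g p (h p u w) (h p v z)
  + (l2 - l1) * (g p u z * one_form g P p (h p v w)
                 - g p v z * one_form g P p (h p u w))
  + l1 * g p v z * (c p u w - l1 * one_form g P p u * one_form g P p w
                    + l2 * g p u w * one_form g P p (P p))
  - l1 * g p u z * (c p v w - l1 * one_form g P p v * one_form g P p w
                    + l2 * g p v w * one_form g P p (P p))
  - l2 * g p v w * (c p u z - l2 * one_form g P p z * one_form g P p u)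
  + l2 * g p u w * (c p v z - l2 * one_form g P p z * one_form g P p v).
Proof.
move=> Mp su sv sw sz; rewrite /sub_curvature.
have [sX] := sub_extendP su; have [sY] := sub_extendP sv.
have [sZ] := sub_extendP sw; have [sW] := sub_extendP sz.
move: (sub_extend n M p u) (sub_extend n M p v) (sub_extend n M p w)
  (sub_extend n M p z) sX sY sZ sW => X Y Z W sX sY sZ sW Wz Zw Yv Xu.
subst u v w z.
have [vX _] := sX; have [vY _] := sY; have [vZ _] := sZ; have [vW _] := sW.
have tX := vfn_tangent vX; have tY := vfn_tangent vY.
have tZ := vfn_tangent vZ; have tW := vfn_tangent vW; have tPp := tP p.
have vXY := vfn_bracket lc vX vY; have tXY := vfn_tangent vXY.
have sXY := bracket_sub lc subM Mp sX sY.
have tDXY := lc_tangent lc tX vY; have tDYX := lc_tangent lc tY vX.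
have tDXZ := lc_tangent lc tX vZ; have tDYZ := lc_tangent lc tY vZ.
have tnXZ := conn_bar_tangent tX vZ; have tnYZ := conn_bar_tangent tY vZ.
have tnXYZ := conn_bar_tangent tXY vZ; have tDXYZ := lc_tangent lc tXY vZ.
have tDXDYZ := lc_tangent lc tX (vfn_conn lc vY vZ).
have tDYDXZ := lc_tangent lc tY (vfn_conn lc vX vZ).
have indXYZ : ind p (bracket X Y p) Z = tan p (nbar p (bracket X Y p) Z).
  by apply: (induced_connE Mp sXY vZ); exact: nearW.
have tind X' Y' : sub_field_near n M p X' -> sub_field_near n M p Y' ->
    tangent p (ind p (X' p) (fun q => ind q (Y' q) Z)).
  move=> sX' sY'; have [F' [vF' F'E _]] := induced_field Mp sY' vZ.
  have tsX' := sub_field_tangent Mp sX'.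
  rewrite (induced_connE Mp tsX' vF' F'E); apply: (tan_part_tangent subM gP) => //.
  exact: (conn_bar_tangent (tangent_sub_tangent tsX')).
have tindXY := tind X Y sX sY; have tindYX := tind Y X sY sX.
have tindZ : tangent p (ind p (bracket X Y p) Z).
  by rewrite indXYZ; exact: (tan_part_tangent subM gP).
have piC v : tangent p v -> one_form g P p v = g p v (P p).
  by move=> tv; exact: (metricC gP).
have pi_tan U : sub_field_near n M p U ->
    one_form g P p (tan p (nbar p (U p) Z)) =
    g p (D p (U p) Z) (P p) + l1 * one_form g P p (Z p) * one_form g P p (U p)
    - l2 * g p (U p) (Z p) * one_form g P p (P p) - one_form g P p (h p (U p) (Z p)).
  move=> sU; have [vU _] := sU; have tU := vfn_tangent vU.
  have tsU := sub_field_tangent Mp sU; have tnU := conn_bar_tangent tU vZ.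
  have ttU := tan_part_tangent subM gP Mp tnU.
  rewrite (second_formE Mp tsU sZ) /normal_part /one_form.
  rewrite [g p (P p) (_ - _)](metricBr gP) //.
  rewrite (metricC gP tPp tnU) conn_bar_metric // /one_form (metricC gP tU tPp).
  by ring.
have g_tan U U' : sub_field_near n M p U -> sub_field_near n M p U' ->
    g p (U' p) (tan p (nbar p (U p) Z)) =
    g p (D p (U p) Z) (U' p) + l1 * one_form g P p (Z p) * g p (U p) (U' p)
    - l2 * g p (U p) (Z p) * one_form g P p (U' p).
  move=> sU sU'; have [[vU _] [vU' _]] := (sU, sU').
  have [tU tU'] := (vfn_tangent vU, vfn_tangent vU').
  have tsU' := sub_field_tangent Mp sU'; have tnU := conn_bar_tangent tU vZ.
  rewrite (metricC gP tU' (tan_part_tangent subM gP Mp tnU)).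
  by rewrite (tan_part_metric subM gP) // conn_bar_metric.
rewrite /curvature (metricBl gP); try solve [auto with tg].
rewrite (metricBl gP); try solve [auto with tg].
rewrite (metricBl gP); try solve [auto with tg].
rewrite (metricBl gP); try solve [auto with tg].
rewrite (induced_induced Mp sX sY sZ sW) (induced_induced Mp sY sX sZ sW) indXYZ.
rewrite (tan_part_metric subM gP) // conn_bar_metric //.
rewrite !lc_conn_bar // !pi_tan // !g_tan // !one_form_deriv //.
rewrite (lc_metric lc tX vY vZ) (lc_metric lc tY vX vZ).
rewrite (second_form_lc Mp su sv sw sW) (second_form_lc Mp sv su sw sW).
(* The bracket is expanded in the metric terms only, where it cancels the derivatives of Y and X; in
   D_[X,Y] Z it has to stay, as part of the ambient curvature. *)
rewrite {2 3}(lc_bracket lc vX vY) !(metricBl gP tDXY tDYX) //.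
rewrite (metricC gP tY tDXZ) (metricC gP tX tDYZ) (metricC gP tY tX).
rewrite (piC _ tDXZ) (piC _ tDYZ) /one_form.
by ring.
Qed.

End Gauss.

(** * Averages over permutations *)

Section Averaging.
Context {R : realType} (n : nat).
Implicit Types (f : 'I_n -> 'I_n -> R) (a b : 'I_n).

(** The symmetric group is doubly transitive: composing with a permutation [t] that sends (a, b) to
    (a', b') reindexes the sum. *)
Lemma perm_pair_sum f a b a' b' : a != b -> a' != b' ->
  \sum_(s : 'S_n) f (s a) (s b) = \sum_(s : 'S_n) f (s a') (s b').
Proof.
(* The first transposition sends a to a' and b to [b1]; the second sends [b1] to b' and fixes a',
   which differs from both. *)
move=> ab ab'; pose b1 := tperm a a' b.
pose t := (tperm a a' * tperm b1 b')%g.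
have b1a' : b1 != a'.
  by rewrite /b1 -[X in _ != X](tpermL a a') (inj_eq perm_inj) eq_sym.
have ta : t a = a' by rewrite permM tpermL tpermD // eq_sym.
have tb : t b = b' by rewrite permM -/b1 tpermL.
rewrite (reindex_inj (mulgI t)) /=; apply: eq_bigr => s _.
by rewrite !(permM t) ta tb.
Qed.

(** Double counting of f (s i) (s j) over all i, j, s: for fixed s the sum over i, j is the full sum
    of f, while for each of the n (n - 1) pairs of distinct i, j the sum over s is the same. *)
Lemma perm_pair_average f a b : a != b -> (forall i, f i i = 0) ->
  (n * n.-1)%:R * \sum_(s : 'S_n) f (s a) (s b) =
  (n`!)%:R * \sum_i \sum_j f i j.
Proof.
move=> ab f0.
have E : \sum_(i : 'I_n) \sum_(j : 'I_n) \sum_(s : 'S_n) f (s i) (s j) =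
    \sum_(i : 'I_n) \sum_(j | j != i) \sum_(s : 'S_n) f (s a) (s b).
  apply: eq_bigr => i _; rewrite (bigD1 i) //= big1 ?add0r //.
  by apply: eq_bigr => j ji; apply: perm_pair_sum => //; rewrite eq_sym.
have -> : (n`!)%:R * \sum_i \sum_j f i j =
    \sum_(i : 'I_n) \sum_(j : 'I_n) \sum_(s : 'S_n) f (s i) (s j).
  under [RHS]eq_bigr do rewrite exchange_big /=.
  rewrite [RHS]exchange_big /=.
  rewrite [RHS](eq_bigr (fun=> \sum_i \sum_j f i j)).
    by rewrite sumr_const mulr_natl card_Sn.
  move=> s _; rewrite [RHS](reindex_inj (@perm_inj _ s)); apply: eq_bigr => i _.
  by rewrite [RHS](reindex_inj (@perm_inj _ s)).
rewrite E [RHS](eq_bigr (fun=> (\sum_(s : 'S_n) f (s a) (s b)) *+ n.-1)).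
  by rewrite [RHS]sumr_const card_ord -mulrnA mulr_natl mulnC.
by move=> i _; rewrite sumr_const cardC1 card_ord.
Qed.

End Averaging.

(** * Expansions in an orthonormal basis and bounds for multilinear forms *)

Section OrthonormalBasis.
Context {R : realType} {d : nat} (N : manifold R d).
Local Notation V := (functional N R).
Context (g : N -> V -> V -> R) (gP : riemannian_metric g).
Context (n : nat) (M : set N) (subM : submanifold n M).
Context (x : N) (Mx : M x) (e : nat -> V) (onb : orthonormal_basis n M g x e).
Local Notation tsub := (tangent_sub n M x).
Implicit Types (u v w z : V).

Lemma onb_sub (i : 'I_n) : tsub (e i).
Proof. by have [H _] := onb; have [] := H i i (ltn_ord i) (ltn_ord i). Qed.

Lemma onb_tangent (i : 'I_n) : tangent x (e i).
Proof. exact: tangent_sub_tangent (onb_sub i). Qed.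

Lemma onb_metric (i j : 'I_n) : g x (e i) (e j) = (i == j)%:R.
Proof. by have [H _] := onb; have [] := H i j (ltn_ord i) (ltn_ord j). Qed.

Lemma onb_sum_sub (a : 'I_n -> R) : tsub (\sum_(i < n) a i *: e i).
Proof.
apply: tangent_sub_sum => // i; apply: tangent_subZ => //; exact: onb_sub.
Qed.

Lemma onb_coord (a : 'I_n -> R) (j : 'I_n) :
  g x (\sum_(i < n) a i *: e i) (e j) = a j.
Proof.
rewrite (metric_suml gP); [|by move=> i; exact/tangentZ/onb_tangent
  |exact: onb_tangent].
rewrite (bigD1 j) //= big1 ?addr0 => [|i ij].
  by rewrite (metricZl gP) ?onb_metric ?eqxx ?mulr1 //; exact: onb_tangent.
by rewrite (metricZl gP) ?onb_metric ?(negbTE ij) ?mulr0 //; exact: onb_tangent.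
Qed.

Lemma onb_expand u : tsub u -> u = \sum_(i < n) g x u (e i) *: e i.
Proof.
have [_ span] := onb; move=> /span[a ->]; apply: eq_bigr => i _.
by rewrite (onb_coord (fun i => a i)).
Qed.

Lemma onb_metric_sum (a b : 'I_n -> R) :
  g x (\sum_(i < n) a i *: e i) (\sum_(i < n) b i *: e i) = \sum_(i < n) a i * b i.
Proof.
rewrite (metric_sumr gP).
- apply: eq_bigr => i _; rewrite (metricZr gP) ?onb_coord 1?mulrC //.
    exact: onb_tangent.
  exact/tangent_sub_tangent/onb_sum_sub.
- by move=> i; exact/tangentZ/onb_tangent.
- exact/tangent_sub_tangent/onb_sum_sub.
Qed.

Definition linear_sub (L : V -> R) :=
  forall (s : R) u v, tsub u -> tsub v -> L (s *: u + v) = s * L u + L v.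

Lemma linear_sub_sum (L : V -> R) (a : 'I_n -> R) : linear_sub L ->
  L (\sum_(i < n) a i *: e i) = \sum_(i < n) a i * L (e i).
Proof.
move=> linL; have L0 : L 0 = 0.
  have := linL (-1) 0 0 (tangent_sub0 subM Mx) (tangent_sub0 subM Mx).
  by rewrite scaler0 addr0 mulN1r addNr.
have [_ ->] : tsub (\sum_(i < n) a i *: e i) /\
    L (\sum_(i < n) a i *: e i) = \sum_(i < n) a i * L (e i); last by [].
elim/big_rec2 : _ => [|i y v _ [sv Lv]]; first by split=> //; exact: tangent_sub0.
have si := onb_sub i; rewrite linL // Lv; split=> //.
exact: (tangent_sub_lin subM).
Qed.

(** The coordinates of a unit vector in an orthonormal basis have absolute value at most 1. *)
Lemma linear_sub_bound (L : V -> R) u : linear_sub L -> tsub u -> g x u u = 1 ->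
  `|L u| <= \sum_(i < n) `|L (e i)|.
Proof.
move=> linL su u1; rewrite (onb_expand su) linear_sub_sum //.
apply: (le_trans (ler_norm_sum _ _ _)); apply: ler_sum => i _.
rewrite normrM; apply: ler_piMl => //.
have : g x u (e i) ^+ 2 <= 1.
  rewrite -u1 [in leRHS](onb_expand su) onb_metric_sum (bigD1 i) //= -expr2.
  by rewrite lerDl sumr_ge0 // => j _; rewrite -expr2 sqr_ge0.
by move=> le1; rewrite -(@expr_le1 _ 2) // -normrX ger0_norm // sqr_ge0.
Qed.

(** Replaces a compactness argument on the unit sphere: the arguments are expanded one after the
    other, and the sum of the absolute values on basis vectors is a bound. *)
Lemma multilinear_bound (T : V -> V -> V -> V -> R) :
  (forall v w z, tsub v -> tsub w -> tsub z -> linear_sub (fun u => T u v w z)) ->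
  (forall u w z, tsub u -> tsub w -> tsub z -> linear_sub (fun v => T u v w z)) ->
  (forall u v z, tsub u -> tsub v -> tsub z -> linear_sub (fun w => T u v w z)) ->
  (forall u v w, tsub u -> tsub v -> tsub w -> linear_sub (fun z => T u v w z)) ->
  exists C, forall u v w z, tsub u -> tsub v -> tsub w -> tsub z ->
    g x u u = 1 -> g x v v = 1 -> g x w w = 1 -> g x z z = 1 ->
    `|T u v w z| <= C.
Proof.
move=> T1 T2 T3 T4; exists (\sum_(i < n) \sum_(j < n) \sum_(k < n) \sum_(l < n)
  `|T (e i) (e j) (e k) (e l)|).
move=> u v w z su sv sw sz u1 v1 w1 z1; have se := onb_sub.
apply: (le_trans (linear_sub_bound (T1 v w z sv sw sz) su u1)).
apply: ler_sum => i _.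
apply: (le_trans (linear_sub_bound (T2 _ w z (se i) sw sz) sv v1)).
apply: ler_sum => j _.
apply: (le_trans (linear_sub_bound (T3 _ _ z (se i) (se j) sz) sw w1)).
apply: ler_sum => k _.
exact: (linear_sub_bound (T4 _ _ _ (se i) (se j) (se k)) sz z1).
Qed.

End OrthonormalBasis.

(** * Double sums of curvature terms *)

Section CurvatureSums.
Context {R : realType} (n : nat).
Implicit Types (m : 'I_n -> 'I_n -> R) (a b : 'I_n -> R).

Definition dsum m : R := \sum_(i < n) \sum_(j < n) m i j.

Lemma dsumD m1 m2 : dsum (fun i j => m1 i j + m2 i j) = dsum m1 + dsum m2.
Proof. by rewrite /dsum -big_split; apply: eq_bigr => i _; rewrite big_split. Qed.

Lemma dsumZ (s : R) m : dsum (fun i j => s * m i j) = s * dsum m.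
Proof. by rewrite /dsum mulr_sumr; apply: eq_bigr => i _; rewrite mulr_sumr. Qed.

Lemma dsum1 : dsum (fun _ _ => 1) = n%:R * n%:R.
Proof. by rewrite /dsum !sumr_const card_ord -mulrnA natrM. Qed.

Lemma dsuml a : dsum (fun i _ => a i) = n%:R * \sum_(i < n) a i.
Proof.
rewrite /dsum mulr_sumr; apply: eq_bigr => i _.
by rewrite sumr_const card_ord mulr_natl.
Qed.

Lemma dsumr b : dsum (fun _ j => b j) = n%:R * \sum_(i < n) b i.
Proof. by rewrite /dsum sumr_const card_ord mulr_natl. Qed.

Lemma dsumM a b :
  dsum (fun i j => a i * b j) = (\sum_(i < n) a i) * \sum_(i < n) b i.
Proof. by rewrite /dsum big_distrlr. Qed.

(** The curvature formula holds only off the diagonal; it is summed over all pairs, where sums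
    factor, and its diagonal is then removed. *)
Lemma dsum_offdiag m m' : (forall i, m i i = 0) ->
  (forall i j, i != j -> m i j = m' i j) ->
  dsum m = dsum m' - \sum_(i < n) m' i i.
Proof.
move=> m0 mm'; rewrite /dsum -sumrB; apply: eq_bigr => i _.
rewrite (bigD1 i) //= m0 add0r [in RHS](bigD1 i) //= addrAC subrr add0r.
by apply: eq_bigr => j ij; rewrite mm' // eq_sym.
Qed.

(** Pure algebra, in matrix entries: [E] stands for eta(e_i), [F], [A], [B] for the entries of phi,
    h', phi h', [K] and [L] for the two products of second fundamental forms, [s] for pi(h(e_i,
    e_i)), [p] for pi(e_i), [C] for g(D_{e_i} P, e_i) and [pP] for pi(P). *)
Lemma curvature_double_sum (T F A B K L : 'I_n -> 'I_n -> R)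
    (E p C s : 'I_n -> R) (k1 k2 k3 mu l1 l2 pP : R) :
  (forall i, T i i = 0) -> (forall i, F i i = 0) -> (forall i, K i i = L i i) ->
  (forall i j, i != j -> T i j =
     k1 - k2 * (E i ^+ 2 + E j ^+ 2) + 3%:R * k3 * F i j ^+ 2
     + 2%:R^-1 * (A i i * A j j - A i j ^+ 2 + B i j ^+ 2 - B i i * B j j)
     + A i i + A j j
     + (1 - mu) * (2%:R * (E i * E j * A i j) - E j ^+ 2 * A i i
                   - E i ^+ 2 * A j j)
     + K i j - L i j + (l2 - l1) * s j
     - l1 * (C j - l1 * p j ^+ 2 + l2 * pP) - l2 * (C i - l2 * p i ^+ 2)) ->
  let N := n%:R in
  let SE := \sum_(i < n) E i ^+ 2 in let trA := \sum_(i < n) A i i in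
  let trB := \sum_(i < n) B i i in
  dsum T = k1 * N * (N - 1) - 2%:R * k2 * (N - 1) * SE
    + 3%:R * k3 * dsum (fun i j => F i j ^+ 2)
    + 2%:R^-1 * (trA ^+ 2 - dsum (fun i j => A i j ^+ 2)
                 + dsum (fun i j => B i j ^+ 2) - trB ^+ 2)
    + 2%:R * (N - 1) * trA
    + 2%:R * (1 - mu) * (dsum (fun i j => E i * E j * A i j) - SE * trA)
    + dsum K - dsum L + (l2 - l1) * (N - 1) * \sum_(i < n) s i
    - (l1 + l2) * (N - 1) * \sum_(i < n) C i
    + (l1 ^+ 2 + l2 ^+ 2) * (N - 1) * \sum_(i < n) p i ^+ 2
    - l1 * l2 * pP * N * (N - 1).
Proof.
move=> T0 F0 KL TE N SE trA trB.
(* [k0] gathers the constant terms and is opaque, so it remains one coefficient until the end. *)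
have [k0 k0E] : exists k0, k0 = k1 - l1 * l2 * pP by eexists.
pose Y i j := k0 * 1 + (- k2) * E i ^+ 2 + (- k2) * E j ^+ 2
  + (3%:R * k3) * F i j ^+ 2 + 2%:R^-1 * (A i i * A j j)
  + (- 2%:R^-1) * A i j ^+ 2 + 2%:R^-1 * B i j ^+ 2
  + (- 2%:R^-1) * (B i i * B j j) + 1 * A i i + 1 * A j j
  + (2%:R * (1 - mu)) * (E i * E j * A i j)
  + (mu - 1) * (A i i * E j ^+ 2) + (mu - 1) * (E i ^+ 2 * A j j)
  + 1 * K i j + (-1) * L i j + (l2 - l1) * s j + (- l1) * C j
  + l1 ^+ 2 * p j ^+ 2 + (- l2) * C i + l2 ^+ 2 * p i ^+ 2.
rewrite (@dsum_offdiag _ Y) //; last by move=> i j /TE ->; rewrite /Y k0E; ring.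
(* On the diagonal the quadratic terms in [A] and in [B], the [mu] terms, and [K] against [L]
   cancel. *)
have -> : \sum_(i < n) Y i i = \sum_(i < n) (k0
    + (- 2%:R * k2) * E i ^+ 2 + 2%:R * A i i + (l2 - l1) * s i
    + (- (l1 + l2)) * C i + (l1 ^+ 2 + l2 ^+ 2) * p i ^+ 2).
  by apply: eq_bigr => i _; rewrite /Y F0 KL; field.
rewrite !big_split /= -!mulr_sumr sumr_const card_ord -/SE -/trA.
rewrite /Y !dsumD !dsumZ dsum1 !dsumr !dsuml !dsumM -/SE -/trA -/trB.
rewrite -(mulr_natl k0) k0E -/N.
move: N SE trA trB (dsum _) (dsum _) (dsum _) (dsum _) (dsum _) (dsum _).
by move: (\sum_(i < n) _) (\sum_(i < n) _) (\sum_(i < n) _) => *; ring.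
Qed.

End CurvatureSums.

(** * Curvature of a submanifold of a contact space form *)

Section SpaceForm.
Context {R : realType} {d : nat} (N : manifold R d).
Local Notation V := (functional N R).
Context (g : N -> V -> V -> R) (phi : N -> V -> V) (xi : N -> V)
  (eta : N -> V -> R) (h' : N -> V -> V) (D : N -> V -> (N -> V) -> V).
Context (kappa mu c : R).
Context (csf : contact_space_form g phi xi eta h' D kappa mu c).
Context (P : N -> V) (vfP : vector_field setT P) (l1 l2 : R).
Context (n : nat) (M : set N) (subM : submanifold n M) (x : N) (Mx : M x).
Implicit Types (u v w z : V).

Let cm : contact_metric g phi xi eta. Proof. by case: csf => -[]. Qed.
Let lieP p X : vector_field_near p X ->
  2%:R *: h' p (X p) = lie_phi phi xi p X.
Proof. by case: csf => -[_ + _ _] _ _; apply. Qed.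
Let lc : levi_civita g D. Proof. by case: csf => -[]. Qed.
Let curvE p X Y Z : vector_field_near p X -> vector_field_near p Y ->
  vector_field_near p Z -> curvature D p X Y Z =
  space_form_curvature g phi xi eta h' kappa mu c p (X p) (Y p) (Z p).
Proof. by case: csf => _ _; apply. Qed.
Let ac : almost_contact_metric g phi xi eta := proj1 cm.
Let gP : riemannian_metric g := ac_metric ac.
Let affD : affine_connection D. Proof. by case: lc. Qed.
Let tP : tangent x (P x).
Proof. by case: vfP => _ + _; apply. Qed.

Local Notation nbar := (conn_bar g D P l1 l2).
Local Notation tsub := (tangent_sub n M x).
Local Notation G := (g x).
Local Notation f := (phi x).
Local Notation A := (h' x).
Local Notation E u := (g x u (xi x)).
Local Notation pi := (one_form g P x).
Local Notation S := (second_form n M g nbar x).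
Local Notation C u w := (g x (D x u P) w).

Let f_tangent u : tangent x u -> tangent x (f u).
Proof. exact: (phi_tangent cm). Qed.
Let A_tangent u : tangent x u -> tangent x (A u).
Proof. exact: (h_tangent cm lieP lc). Qed.
Let xi_tan : tangent x (xi x). Proof. exact: (xi_tangent cm). Qed.
Let S_tangent u w : tsub u -> tsub w -> tangent x (S u w).
Proof. exact: (second_form_tangent gP lc vfP l1 l2 subM Mx). Qed.
Let tsub_tangent u : tsub u -> tangent x u.
Proof. exact: tangent_sub_tangent. Qed.
Let DP_tangent u : tangent x u -> tangent x (D x u P).
Proof.
move=> tu; apply: (lc_tangent lc tu).
by exists setT => //; split=> //; exact: openT.
Qed.

Local Hint Resolve f_tangent A_tangent xi_tan S_tangent tsub_tangent
  DP_tangent tP : tg.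
Local Ltac tg := solve [auto 30 with tg].

Let metricPr (s : R) u v w : tangent x u -> tangent x v -> tangent x w ->
  G w (s *: u + v) = s * G w u + G w v.
Proof.
by move=> tu tv tw; rewrite (metricDr gP) ?(metricZr gP) //; exact: tangentZ.
Qed.

Definition space_form_quad u v w z : R :=
  (c + 3%:R) / 4%:R * (G v w * G u z - G u w * G v z)
  + (c + 3%:R - 4%:R * kappa) / 4%:R *
    (E u * E w * G v z - E v * E w * G u z + G u w * E v * E z
     - G v w * E u * E z)
  + (c - 1) / 4%:R * (2%:R * G u (f v) * G (f w) z + G u (f w) * G (f v) z
     - G v (f w) * G (f u) z)
  + 2%:R^-1 * (G (A v) w * G (A u) z - G (A u) w * G (A v) z
     + G (f (A u)) w * G (f (A v)) z - G (f (A v)) w * G (f (A u)) z)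
  - G u w * G (A v) z + G v w * G (A u) z + E u * E w * G (A v) z
  - E v * E w * G (A u) z - G (A u) w * G v z + G (A v) w * G u z
  - G (A v) w * E u * E z + G (A u) w * E v * E z
  + mu * (E v * E w * G (A u) z - E u * E w * G (A v) z
          + G (A v) w * E u * E z - G (A u) w * E v * E z).

Lemma space_form_quadE u v w z : tangent x u -> tangent x v -> tangent x w ->
  tangent x z ->
  G (space_form_curvature g phi xi eta h' kappa mu c x u v w) z =
  space_form_quad u v w z.
Proof.
move=> tu tv tw tz; rewrite /space_form_curvature /space_form_quad.
rewrite !(etaE cm) //.
rewrite !(metricDl gP, metricBl gP, metricZl gP, metricNl gP); try tg.
by rewrite (metricC gP xi_tan tz); ring.
Qed.

(** The right-hand side of the Gauss equation as a function of four vectors. Unlike [sub_curvature]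
    it contains no chosen extensions, so its linearity in each argument can be verified directly. *)
Definition gauss_quad u v w z : R :=
  space_form_quad u v w z + G (S v w) (S u z) - G (S u w) (S v z)
  + (l2 - l1) * (G u z * pi (S v w) - G v z * pi (S u w))
  + l1 * G v z * (C u w - l1 * pi u * pi w + l2 * G u w * pi (P x))
  - l1 * G u z * (C v w - l1 * pi v * pi w + l2 * G v w * pi (P x))
  - l2 * G v w * (C u z - l2 * pi z * pi u)
  + l2 * G u w * (C v z - l2 * pi z * pi v).

Lemma sub_curvatureE u v w z : tsub u -> tsub v -> tsub w -> tsub z ->
  sub_curvature n M g nbar x u v w z = gauss_quad u v w z.
Proof.
move=> su sv sw sz; rewrite (gauss_equation gP lc vfP l1 l2 subM Mx) //.
have [[vX _] Xx] := sub_extendP su; have [[vY _] Yx] := sub_extendP sv.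
have [[vZ _] Zx] := sub_extendP sw.
by rewrite curvE // Xx Yx Zx space_form_quadE //; exact: tsub_tangent.
Qed.

(** Only the first pair: in the last pair antisymmetry may fail, as nabla-bar need not be metric. *)
Lemma gauss_quad_anti u v w z : tangent x u -> tangent x v ->
  gauss_quad v u w z = - gauss_quad u v w z.
Proof.
move=> tu tv; rewrite /gauss_quad /space_form_quad.
by rewrite (ac_g_phi ac tv tu) (metricC gP (f_tangent tv) tu); ring.
Qed.

Lemma gauss_quad_lin1 v w z : tsub v -> tsub w -> tsub z ->
  linear_sub n M x (fun u => gauss_quad u v w z).
Proof.
move=> sv sw sz s u u' su su'; rewrite /gauss_quad /space_form_quad.
have [tu tu'] := (tsub_tangent su, tsub_tangent su').
rewrite (h_lin cm lieP lc s tu tu') !(second_form_linl gP lc vfP l1 l2 subM) //.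
rewrite (conn_linear affD s tu tu'); last first.
  by exists setT => //; split=> //; exact: openT.
rewrite !(ac_phi_linear ac) /one_form; try tg.
rewrite !(metricPl gP); try tg.
rewrite !metricPr; try tg.
by ring.
Qed.

Lemma gauss_quad_lin2 u w z : tsub u -> tsub w -> tsub z ->
  linear_sub n M x (fun v => gauss_quad u v w z).
Proof.
move=> su sw sz s v v' sv sv'.
have suv := tangent_sub_lin subM s Mx sv sv'.
have anti y : tsub y -> gauss_quad u y w z = - gauss_quad y u w z.
  by move=> sy; apply: gauss_quad_anti; exact: tsub_tangent.
by rewrite !anti // (gauss_quad_lin1 su sw sz s sv sv'); ring.
Qed.

Lemma gauss_quad_lin3 u v z : tsub u -> tsub v -> tsub z ->
  linear_sub n M x (fun w => gauss_quad u v w z).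
Proof.
move=> su sv sz s w w' sw sw'; rewrite /gauss_quad /space_form_quad.
have [tw tw'] := (tsub_tangent sw, tsub_tangent sw').
rewrite !(second_form_linr gP lc vfP l1 l2 subM) //.
rewrite !(ac_phi_linear ac) /one_form; try tg.
rewrite !(metricPl gP); try tg.
rewrite !metricPr; try tg.
by ring.
Qed.

Lemma gauss_quad_lin4 u v w : tsub u -> tsub v -> tsub w ->
  linear_sub n M x (fun z => gauss_quad u v w z).
Proof.
move=> su sv sw s z z' sz sz'; rewrite /gauss_quad /space_form_quad.
have [tz tz'] := (tsub_tangent sz, tsub_tangent sz').
rewrite !(second_form_linr gP lc vfP l1 l2 subM) /one_form //.
rewrite !(metricPl gP); try tg.
rewrite !metricPr; try tg.
by ring.
Qed.

(** * Sectional curvatures in an orthonormal basis and the bound by [Theta] *)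

Context (e : nat -> V) (onb : orthonormal_basis n M g x e).
Local Notation K u v := (sub_sectional n M g nbar x u v).

Let se (i : 'I_n) : tsub (e i). Proof. exact: (onb_sub onb). Qed.
Let te (i : 'I_n) : tangent x (e i). Proof. exact: tsub_tangent. Qed.

(* Needed because [inf] of a set without lower bound is the junk value 0. *)
Lemma sectional_bound : exists B, forall u v, tsub u -> tsub v ->
  G u u = 1 -> G v v = 1 -> B <= K u v.
Proof.
have [B TB] := multilinear_bound gP subM Mx onb gauss_quad_lin1 gauss_quad_lin2
  gauss_quad_lin3 gauss_quad_lin4.
exists (- B) => u v su sv u1 v1; rewrite /sub_sectional !sub_curvatureE //.
have := TB u v v u su sv sv su u1 v1 v1 u1.
have := TB u v u v su sv su sv u1 v1 u1 v1.
by rewrite !ler_norml => /andP[? ?] /andP[? ?]; lra.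
Qed.

Lemma Theta_le k (e' : nat -> V) : (2 <= k)%N -> orthonormal_frame n M g k x e' ->
  k.-1%:R * Theta n M g nbar k x <= k_ricci n M g nbar k x e'.
Proof.
move=> k2 fe'; rewrite /Theta mulrA divff ?mul1r; last first.
  by rewrite pnatr_eq0 -lt0n; case: k k2 {fe'} => [|[]].
apply: ge_inf; last by exists e'.
have [B KB] := sectional_bound; exists (\sum_(1 <= j < k) B) => _ [f0 ff0 <-].
rewrite /k_ricci !big_nat; apply: ler_sum => j /andP[_ jk].
have k0 : (0 < k)%N by exact: leq_trans k2.
have [s0 g0] := ff0 0%N 0%N k0 k0; have [sj gj] := ff0 j j jk jk.
by apply: KB; rewrite // ?g0 ?gj ?eqxx.
Qed.

Lemma sectional_self u : tsub u -> K u u = 0.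
Proof. by move=> su; rewrite /sub_sectional subrr mulr0. Qed.

Lemma Theta_average k : (2 <= k)%N -> (k <= n)%N ->
  n%:R * (n%:R - 1) * Theta n M g nbar k x <=
  dsum (fun i j : 'I_n => K (e i) (e j)).
Proof.
move=> k2 kn; set Th := Theta _ _ _ _ _ _.
have n0 : (0 < n)%N by exact: leq_trans (leq_trans _ k2) kn.
pose F (i j : 'I_n) := K (e i) (e j).
pose i0 := Ordinal n0.
have F0 i : F i i = 0 by exact: sectional_self.
(* [insubd] turns a position into an index below n; its default [i0] is not reached at positions
   below [k], as k <= n. *)
pose frame (s : 'S_n) (i : nat) : V := e (s (insubd i0 i)).
have ins (i : nat) : (i < k)%N -> val (insubd i0 i) = i.
  by move=> ik; rewrite val_insubd (leq_trans ik kn).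
have frameP s : orthonormal_frame n M g k x (frame s).
  move=> i j ik jk; split; first exact: se.
  rewrite (onb_metric onb) (inj_eq perm_inj); congr (_%:R).
  by rewrite -val_eqE /= !ins.
have frame0 s : frame s 0%N = e (s i0).
  rewrite /frame; congr (e (nat_of_ord (s _))); apply: val_inj.
  by rewrite /= ins // (leq_trans _ k2).
have kR : 0 < k.-1%:R :> R by rewrite ltr0n; case: k k2 {kn Th ins frameP} => [|[]].
have fR : 0 < n`!%:R :> R by rewrite ltr0n fact_gt0.
(* By [perm_pair_sum], each of the k - 1 terms of [k_ricci], summed over all permuted frames, equals
   this same [w]. *)
pose w := \sum_(s : 'S_n) F (s i0) (s (insubd i0 1%N)).
have wE : (n * n.-1)%:R * w = n`!%:R * dsum F.
  apply: perm_pair_average => //; rewrite -val_eqE /= ins //; exact: k2.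
have wTh : n`!%:R * Th <= w.
  rewrite -(ler_pM2l kR).
  have -> : k.-1%:R * w = \sum_(s : 'S_n) k_ricci n M g nbar k x (frame s).
    rewrite /k_ricci [RHS]exchange_big /= [RHS](eq_big_nat _ _ (F2 := fun=> w)).
      by rewrite sumr_const_nat subn1 mulr_natl.
    move=> j /andP[j1 jk]; rewrite /w [RHS](@perm_pair_sum _ _ F _ _ i0 (insubd i0 j)).
    - by apply: eq_bigr => s _; rewrite frame0.
    - by rewrite -val_eqE /= ins.
    - by rewrite -val_eqE /= ins // eq_sym -lt0n.
  have -> : k.-1%:R * (n`!%:R * Th) = \sum_(s : 'S_n) (k.-1%:R * Th).
    by rewrite sumr_const card_Sn -[RHS]mulr_natl mulrCA.
  by apply: ler_sum => s _; exact: Theta_le.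
rewrite -(ler_pM2l fR) -/F -wE natrM -subn1 natrB // mulrCA.
by apply: ler_wpM2l => //; rewrite mulr_ge0 // subr_ge0 ler1n.
Qed.

(** By antisymmetry in the first pair, K(e_i, e_j) is the mean of R(e_i,e_j,e_j,e_i) and
    R(e_j,e_i,e_i,e_j), and exchanging i and j shows that both have the same double sum. *)
Lemma dsum_sectional :
  dsum (fun i j : 'I_n => K (e i) (e j)) =
  dsum (fun i j : 'I_n => gauss_quad (e i) (e j) (e j) (e i)).
Proof.
set T := (RHS in _ = RHS); have TC : T =
    dsum (fun i j : 'I_n => gauss_quad (e j) (e i) (e i) (e j)).
  by rewrite /T /dsum exchange_big.
have -> : T = 2%:R^-1 * T + 2%:R^-1 * T by field.
rewrite {2}TC -!dsumZ -dsumD; apply: eq_bigr => i _; apply: eq_bigr => j _.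
rewrite /sub_sectional !sub_curvatureE // (gauss_quad_anti (e i) (e j) (te j) (te i)).
by ring.
Qed.

(** Skewness of phi merges the phi terms into one square with factor 3, and symmetry of h' and phi
    h' turns their mixed products into squares. *)
Lemma gauss_quad_onb (i j : 'I_n) : i != j ->
  gauss_quad (e i) (e j) (e j) (e i) =
  (c + 3%:R) / 4%:R - (c + 3%:R - 4%:R * kappa) / 4%:R
    * (E (e i) ^+ 2 + E (e j) ^+ 2)
  + 3%:R * ((c - 1) / 4%:R) * G (e i) (f (e j)) ^+ 2
  + 2%:R^-1 * (G (e i) (A (e i)) * G (e j) (A (e j)) - G (e i) (A (e j)) ^+ 2
     + G (e i) (f (A (e j))) ^+ 2
     - G (e i) (f (A (e i))) * G (e j) (f (A (e j))))
  + G (e i) (A (e i)) + G (e j) (A (e j))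
  + (1 - mu) * (2%:R * (E (e i) * E (e j) * G (e i) (A (e j)))
      - E (e j) ^+ 2 * G (e i) (A (e i)) - E (e i) ^+ 2 * G (e j) (A (e j)))
  + G (S (e j) (e j)) (S (e i) (e i)) - G (S (e i) (e j)) (S (e i) (e j))
  + (l2 - l1) * pi (S (e j) (e j))
  - l1 * (C (e j) (e j) - l1 * pi (e j) ^+ 2 + l2 * pi (P x))
  - l2 * (C (e i) (e i) - l2 * pi (e i) ^+ 2).
Proof.
move=> ij; rewrite /gauss_quad /space_form_quad !(onb_metric onb) !eqxx.
rewrite (eq_sym j) (negbTE ij) /=.
rewrite (second_formC gP lc vfP l1 l2 subM Mx (se j) (se i)).
have fjj : G (e j) (f (e j)) = 0.
  have := ac_g_phi ac (te j) (te j); rewrite (metricC gP (f_tangent (te j))) //.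
  by move=> H; lra.
rewrite fjj (metricC gP (f_tangent (te j)) (te i)).
rewrite -!(h_sym cm lieP lc (te _) (te _)) -!(phi_h_sym cm lieP lc (te _) (te _)).
rewrite (h_sym cm lieP lc (te j) (te i)) (metricC gP (A_tangent (te j)) (te i)).
rewrite (phi_h_sym cm lieP lc (te j) (te i)).
rewrite (metricC gP (f_tangent (A_tangent (te j))) (te i)).
by ring.
Qed.

Lemma onb_tan_part (i : 'I_n) v : tangent x v -> G (e i) (tan_part n M g x v) = G (e i) v.
Proof.
move=> tv; have tt := tan_part_tangent subM gP Mx tv.
by rewrite (metricC gP (te i) tt) (tan_part_metric subM gP) // (metricC gP tv).
Qed.

Lemma onb_xi_tan : tan_part n M g x (xi x) = \sum_(i < n) E (e i) *: e i.
Proof.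
have txi := tan_part_sub subM gP Mx xi_tan.
rewrite (onb_expand gP onb txi); apply: eq_bigr => i _.
by rewrite (tan_part_metric subM gP) // (metricC gP xi_tan).
Qed.

Lemma metric_h_xi_tan : let xiT := tan_part n M g x (xi x) in
  G xiT (A xiT) = dsum (fun i j : 'I_n => E (e i) * E (e j) * G (e i) (A (e j))).
Proof.
rewrite /= onb_xi_tan; set w := \sum_(i < n) _.
have sw : tsub w by exact: (onb_sum_sub subM Mx onb).
have tw := tsub_tangent sw.
have linA : linear_sub n M x (fun v => G w (A v)).
  move=> s u v /tsub_tangent tu /tsub_tangent tv.
  by rewrite (h_lin cm lieP lc) // metricPr //; tg.
rewrite {2}/w (linear_sub_sum subM Mx onb _ linA) /dsum exchange_big /=.
apply: eq_bigr => j _; rewrite /w (metric_suml gP); last by tg.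
  rewrite mulr_sumr; apply: eq_bigr => i _.
  by rewrite (metricZl gP) ?mulrA 1?[E (e j) * _]mulrC //; tg.
by move=> i; exact/tangentZ/te.
Qed.

(** Metric compatibility makes the extension chosen in [cov_one_form] drop out. *)
Lemma cov_one_formE u w : tangent x u -> tangent x w ->
  cov_one_form g D P x u w = C u w.
Proof.
move=> tu tw; rewrite /cov_one_form.
have [vY Yw] : vector_field_near x (extend x w) /\ extend x w x = w.
  apply: (@xgetPex _ (fun=> 0) [set Y | vector_field_near x Y /\ Y x = w]).
  by have [Y vY Yw] := vfn_exists tw; exists Y.
have vP : vector_field_near x P by exists setT => //; split=> //; exact: openT.
by rewrite (lc_metric lc tu vP vY) Yw /one_form addrK.
Qed.

(** * Mean curvature and the total curvature sum *)

Local Notation H := (mean_curvature n M g nbar x e).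

Let tS (i j : 'I_n) : tangent x (S (e i) (e j)). Proof. exact: S_tangent. Qed.

Lemma mean_curvatureE : (0 < n)%N ->
  n%:R *: H = \sum_(i < n) S (e i) (e i).
Proof.
by move=> n0; rewrite /mean_curvature scalerA divff ?scale1r // pnatr_eq0 -lt0n.
Qed.

Lemma mean_curvature_tangent : tangent x H.
Proof. by apply/tangentZ/tangent_sum => i; exact: tS. Qed.

Lemma metric_mean_curvature v : (0 < n)%N -> tangent x v ->
  n%:R * G H v = \sum_(i < n) G (S (e i) (e i)) v.
Proof.
move=> n0 tv; rewrite -(metricZl gP _ mean_curvature_tangent) // mean_curvatureE //.
by rewrite (metric_suml gP) // => i; exact: tS.
Qed.

Lemma mean_curvature_norm2 : (0 < n)%N ->
  dsum (fun i j : 'I_n => G (S (e j) (e j)) (S (e i) (e i))) =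
  n%:R * n%:R * G H H.
Proof.
move=> n0; have tH := mean_curvature_tangent.
rewrite -mulrA (metric_mean_curvature n0 tH) mulr_sumr; apply: eq_bigr => i _.
by rewrite (metricC gP _ tH) // metric_mean_curvature.
Qed.

(** The off-diagonal terms are nonnegative, and on the diagonal the gap is a variance: the sum of
    |h(e_i, e_i) - H|^2. *)
Lemma second_form_norm2_ge : (0 < n)%N ->
  n%:R * G H H <= dsum (fun i j : 'I_n => G (S (e i) (e j)) (S (e i) (e j))).
Proof.
move=> n0; have tH := mean_curvature_tangent.
have le1 : \sum_(i < n) G (S (e i) (e i)) (S (e i) (e i)) <=
    dsum (fun i j : 'I_n => G (S (e i) (e j)) (S (e i) (e j))).
  apply: ler_sum => i _; rewrite [leRHS](bigD1 i) //= lerDl.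
  by apply: sumr_ge0 => j _; exact: (metric_ge0 gP).
apply: le_trans le1; rewrite -subr_ge0.
have -> : \sum_(i < n) G (S (e i) (e i)) (S (e i) (e i)) - n%:R * G H H =
    \sum_(i < n) G (S (e i) (e i) - H) (S (e i) (e i) - H).
  transitivity (\sum_(i < n) (G (S (e i) (e i)) (S (e i) (e i))
      + (- 2%:R) * G (S (e i) (e i)) H + G H H)).
    rewrite !big_split /= -mulr_sumr -metric_mean_curvature //.
    by rewrite sumr_const card_ord -[G H H *+ n]mulr_natl; ring.
  apply: eq_bigr => i _; have tSi := tS i i.
  rewrite (metricBl gP tSi tH (tangentB tSi tH)) (metricBr gP tSi tH tSi).
  by rewrite (metricBr gP tSi tH tH) (metricC gP tH tSi); ring.
by apply: sumr_ge0 => i _; apply: (metric_ge0 gP); exact: tangentB.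
Qed.

Lemma curvature_sum : dsum (fun i j : 'I_n => K (e i) (e j)) =
  let trA := \sum_(i < n) G (e i) (A (e i)) in
  let trB := \sum_(i < n) G (e i) (f (A (e i))) in
  let E2 := \sum_(i < n) E (e i) ^+ 2 in
  (c + 3%:R) / 4%:R * n%:R * (n%:R - 1)
  - 2%:R * ((c + 3%:R - 4%:R * kappa) / 4%:R) * (n%:R - 1) * E2
  + 3%:R * ((c - 1) / 4%:R) * dsum (fun i j : 'I_n => G (e i) (f (e j)) ^+ 2)
  + 2%:R^-1 * (trA ^+ 2 - dsum (fun i j : 'I_n => G (e i) (A (e j)) ^+ 2)
     + dsum (fun i j : 'I_n => G (e i) (f (A (e j))) ^+ 2) - trB ^+ 2)
  + 2%:R * (n%:R - 1) * trA
  + 2%:R * (1 - mu)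
    * (dsum (fun i j : 'I_n => E (e i) * E (e j) * G (e i) (A (e j))) - E2 * trA)
  + dsum (fun i j : 'I_n => G (S (e j) (e j)) (S (e i) (e i)))
  - dsum (fun i j : 'I_n => G (S (e i) (e j)) (S (e i) (e j)))
  + (l2 - l1) * (n%:R - 1) * \sum_(i < n) pi (S (e i) (e i))
  - (l1 + l2) * (n%:R - 1) * \sum_(i < n) C (e i) (e i)
  + (l1 ^+ 2 + l2 ^+ 2) * (n%:R - 1) * \sum_(i < n) pi (e i) ^+ 2
  - l1 * l2 * pi (P x) * n%:R * (n%:R - 1).
Proof.
(* The diagonal conditions hold by antisymmetry of the curvature in its first pair and skewness of
   phi; the two products of second fundamental forms coincide for i = j. *)
rewrite dsum_sectional; apply: curvature_double_sum => [i|i|//|].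
- by have := gauss_quad_anti (e i) (e i) (te i) (te i) => H; lra.
- have := ac_g_phi ac (te i) (te i).
  by rewrite (metricC gP (f_tangent (te i))) // => H; lra.
- exact: gauss_quad_onb.
Qed.

End SpaceForm.

(** * The inequality for [Theta] *)

Theorem theorem3p4 (R : realType) (m : nat) (N : manifold R (m.*2).+1)
    (g : N -> functional N R -> functional N R -> R)
    (phi : N -> functional N R -> functional N R)
    (xi : N -> functional N R)
    (eta : N -> functional N R -> R)
    (h' : N -> functional N R -> functional N R)
    (nabla : N -> functional N R -> (N -> functional N R) -> functional N R)
    (kappa mu c : R)
    (P : N -> functional N R) (lambda1 lambda2 : R)
    (n : nat) (M : set N) (k : nat) (x : N) (e : nat -> functional N R) :
  contact_space_form g phi xi eta h' nabla kappa mu c ->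
  vector_field setT P ->
  (3 <= n)%N -> submanifold n M ->
  (2 <= k)%N -> (k <= n)%N ->
  M x -> orthonormal_basis n M g x e ->
  let nbar := conn_bar g nabla P lambda1 lambda2 in
  let H := mean_curvature n M g nbar x e in
  let xiT := tan_part n M g x (xi x) in
  let phiT := fun u => tan_part n M g x (phi x u) in
  let hT := fun u => tan_part n M g x (h' x u) in
  let phihT := fun u => tan_part n M g x (phi x (h' x u)) in
  let lambda :=
    bilinear_trace n (tensor_alpha g nabla P lambda1 lambda2 x) e in
  let trbeta := bilinear_trace n (tensor_beta g P x) e in
  let trh := endo_trace n g x hT e in
  let trphih := endo_trace n g x phihT e in
  n%:R * (n%:R - 1) * Theta n M g nbar k x
  - (c + 3%:R) / 4%:R * (n%:R - 1) * n%:R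
  - 3%:R * (c - 1) / 4%:R * endo_norm2 n g x phiT e
  + (c + 3%:R - 4%:R * kappa) / 2%:R * (n%:R - 1) * g x xiT xiT
  - 2%:R^-1 * (endo_norm2 n g x phihT e - endo_norm2 n g x hT e
               + `|trh| ^+ 2 - `|trphih| ^+ 2)
  - 2%:R * (n%:R - 1) * trh
  - 2%:R * (1 - mu) * (g x xiT (h' x xiT) - trh * g x xiT xiT)
  + lambda * (n%:R - 1) * (lambda1 + lambda2)
  + lambda2 * (lambda1 - lambda2) * (n%:R - 1) * trbeta
  + (n%:R - 1) * n%:R * (lambda1 - lambda2) * one_form g P x H
  <= n%:R * (n%:R - 1) * g x H H.

Proof.
move=> csf vfP n3 subM k2 kn Mx onb /=.
set nbar := conn_bar _ _ _ _ _; set H := mean_curvature _ _ _ _ _ _.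
set xiT := tan_part _ _ _ _ (xi x).
have [[cm lieP lc _] _ _] := csf; have gP := ac_metric (proj1 cm).
have n0 : (0 < n)%N by exact: leq_trans n3.
have te := onb_tangent onb.
have tP : tangent x (P x) by case: vfP => _ + _; apply.
have tS (i : 'I_n) : tangent x (second_form n M g nbar x (e i) (e i)).
  by apply: (second_form_tangent gP lc vfP lambda1 lambda2 subM Mx);
    exact: (onb_sub onb).
have tH : tangent x H.
  exact: (mean_curvature_tangent csf vfP lambda1 lambda2 subM Mx onb).
have norm2 (A : functional N R -> functional N R) :
    (forall u, tangent x u -> tangent x (A u)) ->
    endo_norm2 n g x (fun u => tan_part n M g x (A u)) e =
    dsum (fun i j : 'I_n => g x (e i) (A (e j)) ^+ 2).
  move=> tA; apply: eq_bigr => i _; apply: eq_bigr => j _.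
  by rewrite (onb_tan_part csf subM Mx onb) //; exact/tA.
have trace (A : functional N R -> functional N R) :
    (forall u, tangent x u -> tangent x (A u)) ->
    endo_trace n g x (fun u => tan_part n M g x (A u)) e =
    \sum_(i < n) g x (e i) (A (e i)).
  move=> tA; apply: eq_bigr => i _.
  by rewrite (onb_tan_part csf subM Mx onb) //; exact/tA.
have tphi u : tangent x u -> tangent x (phi x u) by exact: (phi_tangent cm).
have th u : tangent x u -> tangent x (h' x u) by exact: (h_tangent cm lieP lc).
have tphih u : tangent x u -> tangent x (phi x (h' x u)).
  by move=> tu; apply: tphi; exact: th.
rewrite !norm2 // !trace //.
have -> : g x xiT (h' x xiT) = dsum (fun i j : 'I_n =>
    g x (e i) (xi x) * g x (e j) (xi x) * g x (e i) (h' x (e j))).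
  exact: (metric_h_xi_tan csf subM Mx onb).
have -> : g x xiT xiT = \sum_(i < n) g x (e i) (xi x) ^+ 2.
  rewrite /xiT (onb_xi_tan csf subM Mx onb) (onb_metric_sum gP subM Mx onb).
  by apply: eq_bigr => i _; rewrite expr2.
have -> : bilinear_trace n (tensor_alpha g nabla P lambda1 lambda2 x) e =
    \sum_(i < n) g x (nabla x (e i) P) (e i)
    - lambda1 * \sum_(i < n) one_form g P x (e i) ^+ 2
    + lambda2 / 2%:R * one_form g P x (P x) * n%:R.
  transitivity (\sum_(i < n) (g x (nabla x (e i) P) (e i)
      + (- lambda1) * one_form g P x (e i) ^+ 2
      + lambda2 / 2%:R * one_form g P x (P x))).
    apply: eq_bigr => i _; rewrite /tensor_alpha (cov_one_formE csf vfP) //.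
    by rewrite (onb_metric onb) eqxx /=; ring.
  rewrite !big_split /= -mulr_sumr sumr_const card_ord -[_ *+ n]mulr_natr.
  by ring.
have -> : bilinear_trace n (tensor_beta g P x) e =
    one_form g P x (P x) / 2%:R * n%:R + \sum_(i < n) one_form g P x (e i) ^+ 2.
  transitivity (\sum_(i < n) (one_form g P x (P x) / 2%:R
      + one_form g P x (e i) ^+ 2)).
    by apply: eq_bigr => i _; rewrite /tensor_beta (onb_metric onb) eqxx /=; ring.
  by rewrite big_split /= sumr_const card_ord -[_ *+ n]mulr_natr.
have piH : n%:R * one_form g P x H =
    \sum_(i < n) one_form g P x (second_form n M g nbar x (e i) (e i)).
  rewrite {1}/one_form (metricC gP tP tH).
  rewrite (metric_mean_curvature csf vfP lambda1 lambda2 subM Mx onb n0 tP).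
  by apply: eq_bigr => i _; rewrite (metricC gP).
have := second_form_norm2_ge csf vfP lambda1 lambda2 subM Mx onb n0.
rewrite -subr_ge0 => le1.
have := Theta_average csf vfP lambda1 lambda2 subM Mx onb k2 kn.
rewrite (curvature_sum csf vfP lambda1 lambda2 subM Mx onb) /=.
rewrite (mean_curvature_norm2 csf vfP lambda1 lambda2 subM Mx onb n0).
rewrite -piH -subr_ge0 => le2.
rewrite !real_normK ?num_real // -/nbar -/H -subr_ge0.
(* The two sides of the claim differ by exactly the sum of the two gaps. For the P terms, the traces
   of alpha and beta combine to (n - 1) times (l1 + l2) sum g(D_{e_i} P, e_i) - (l1^2 + l2^2) sum
   pi(e_i)^2 + l1 l2 n pi(P), as in [curvature_sum] up to sign. *)
apply: etrans (addr_ge0 le1 le2); congr (_ <= _).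
by rewrite -/nbar -/H; field.
Qed.
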